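(* Let $\Omega$ be a bounded domain in $\mathbb{C}^{n+1}$ and let $\xi_0\in\partial\Omega$. If $\partial\Omega$ is $\mathcal{C}^2$ strongly pseudoconvex at $\xi_0$, then for every sufficiently small neighborhood $U_0$ of $\xi_0$, $$\lim_{\Omega\cap U_0\ni z\to\xi_0}\sigma_{\Omega\cap U_0}(z)=1,$$ where $\sigma_{\Omega\cap U_0}$ denotes the squeezing function of $\Omega\cap U_0$.
   Context: Squeezing function. Let $D\subset\mathbb{C}^{n+1}$ be a bounded domain. Write $B(z,r)$ for the Euclidean open ball of center $z$ and radius $r$, and $\mathbb{B}^{n+1}=B(0,1)$. For $p\in D$ and a holomorphic embedding (injective holomorphic map) $f\colon D\to\mathbb{B}^{n+1}$ with $f(p)=0$, set $\sigma_D(p,f):=\sup\{r>0: B(0,r)\subset f(D)\}$. The squeezing function is $\sigma_D(p):=\sup_f\sigma_D(p,f)$, the supremum being over all such $f$. The function $\sigma_{\Omega\cap U_0}$ is called the localized squeezing function; neighborhoods $U_0$ are open and such that $\Omega\cap U_0$ is a domain. ''$\partial\Omega$ is $\mathcal{C}^2$ strongly pseudoconvex at $\xi_0$'' means: there are a neighborhood $U$ of $\xi_0$ and a real-valued $\mathcal{C}^2$ function $\rho$ on $U$ with $d\rho\neq0$ on $U\cap \partial\Omega$, $\Omega\cap U=\{\rho<0\}$, $\partial\Omega\cap U=\{\rho=0\}$, and the Levi form of $\rho$ at $\xi_0$ is positive definite on the complex tangent space to $\partial\Omega$ at $\xi_0$. ''For every sufficiently small neighborhood $U_0$'' means: there is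 a neighborhood $V$ of $\xi_0$ such that the statement holds for all open neighborhoods $U_0\subset V$ of $\xi_0$ such that $\Omega\cap U_0$ is a domain. *)

(* Defs.v *)
From HB Require Import structures.
From mathcomp Require Import all_boot all_order all_algebra.
From mathcomp Require Import complex.
From mathcomp Require Import all_classical all_reals all_analysis.

Set Implicit Arguments.
Unset Strict Implicit.
Unset Printing Implicit Defensive.

Import Order.TTheory GRing.Theory Num.Theory.
Import numFieldNormedType.Exports.

Local Open Scope classical_set_scope.
Local Open Scope ring_scope.
Local Open Scope complex_scope.

(* R[i] carries the topology of its norm, as the library's numFieldType
   variables do (cf. numFieldNormedType). *)
Section complex_normed.
Variable R : realType.
HB.instance Definition _ := GRing.ComAlgebra.copy R[i] R[i]^o.
HB.instance Definition _ := Vector.copy R[i] R[i]^o.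
HB.instance Definition _ := NormedModule.copy R[i] R[i]^o.
End complex_normed.

Definition boundary (T : topologicalType) (A : set T) : set T :=
  closure A `\` A°.

Definition domain (T : topologicalType) (D : set T) : Prop :=
  [/\ open D, connected D & D !=set0].

(* The library norm on 'rV[R[i]]_m is the max norm with values in R[i]: it
   yields the usual topology, but not Euclidean balls. *)
Definition enorm (R : realType) (m : nat) (z : 'rV[R[i]]_m) : R :=
  Num.sqrt (\sum_(j < m) Normc.normc (z 0 j) ^+ 2).

Definition eball (R : realType) (m : nat) (z : 'rV[R[i]]_m) (r : R) :
  set 'rV[R[i]]_m := [set w | enorm (w - z) < r].

(* [differentiable] is Frechet differentiability over the scalar field R[i],
   that is, complex differentiability. *)
Definition holomorphic_on (R : realType) (m k : nat)
    (D : set 'rV[R[i]]_m) (f : 'rV[R[i]]_m -> 'rV[R[i]]_k) : Prop :=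
  forall z, D z -> differentiable f z.

(* Maps on D are total functions whose values outside D are irrelevant. *)
Definition ball_embedding (R : realType) (m : nat) (D : set 'rV[R[i]]_m)
    (p : 'rV[R[i]]_m) (f : 'rV[R[i]]_m -> 'rV[R[i]]_m) : Prop :=
  [/\ holomorphic_on D f, set_inj D f, f @` D `<=` eball 0 1 & f p = 0].

(* [sup] is real-valued, with sup set0 = 0.  For an embedding f into the unit
   ball and 0 < m, the set of radii is bounded above by 1. *)
Definition squeezing_at (R : realType) (m : nat) (D : set 'rV[R[i]]_m)
    (f : 'rV[R[i]]_m -> 'rV[R[i]]_m) : R :=
  sup [set r : R | 0 < r /\ eball 0 r `<=` f @` D].

Definition squeezing (R : realType) (m : nat) (D : set 'rV[R[i]]_m)
    (p : 'rV[R[i]]_m) : R :=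
  sup [set squeezing_at D f | f in ball_embedding D p].

(* R[i]^m as the real normed space R^(m + m), z = x + i y being (x, y); real
   derivatives of functions on R[i]^m are taken through this identification. *)
Definition of_real (R : realType) (m : nat) (x : 'rV[R]_(m + m)) :
    'rV[R[i]]_m :=
  \row_j (x 0 (lshift m j) +i* x 0 (rshift m j)).

Definition to_real (R : realType) (m : nat) (z : 'rV[R[i]]_m) :
    'rV[R]_(m + m) :=
  row_mx (\row_j complex.Re (z 0 j)) (\row_j complex.Im (z 0 j)).

Definition rdifferentiable (R : realType) (m : nat) (f : 'rV[R[i]]_m -> R)
    (z : 'rV[R[i]]_m) : Prop :=
  differentiable (f \o @of_real R m) (to_real z).

Definition rdiff (R : realType) (m : nat) (f : 'rV[R[i]]_m -> R)
    (z v : 'rV[R[i]]_m) : R :=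
  'd (f \o @of_real R m) (to_real z) (to_real v).

Fixpoint Ck_on (R : realType) (m k : nat) (U : set 'rV[R[i]]_m)
    (f : 'rV[R[i]]_m -> R) : Prop :=
  if k is k'.+1 then
    (forall z, U z -> rdifferentiable f z) /\
    (forall v, Ck_on k' U (fun z => rdiff f z v))
  else forall z, U z -> {for z, continuous f}.

Definition crdiff (R : realType) (m : nat) (f : 'rV[R[i]]_m -> R[i])
    (z v : 'rV[R[i]]_m) : R[i] :=
  rdiff (fun w => complex.Re (f w)) z v +i* rdiff (fun w => complex.Im (f w)) z v.

(* Wirtinger derivatives d/dz_j = (d/dx_j - i d/dy_j) / 2 and
   d/dzbar_j = (d/dx_j + i d/dy_j) / 2. *)
Definition dz (R : realType) (m : nat) (j : 'I_m) (f : 'rV[R[i]]_m -> R[i])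
    (z : 'rV[R[i]]_m) : R[i] :=
  (crdiff f z (delta_mx 0 j) - 'i%C * crdiff f z ('i%C *: delta_mx 0 j)) / 2.

Definition dzbar (R : realType) (m : nat) (j : 'I_m)
    (f : 'rV[R[i]]_m -> R[i]) (z : 'rV[R[i]]_m) : R[i] :=
  (crdiff f z (delta_mx 0 j) + 'i%C * crdiff f z ('i%C *: delta_mx 0 j)) / 2.

Definition levi_form (R : realType) (m : nat) (rho : 'rV[R[i]]_m -> R)
    (z t : 'rV[R[i]]_m) : R[i] :=
  \sum_(j < m) \sum_(k < m)
    dz j (dzbar k (fun w => (rho w)%:C)) z * t 0 j * ((t 0 k)^*)%C.

Definition complex_tangent (R : realType) (m : nat) (rho : 'rV[R[i]]_m -> R)
    (z : 'rV[R[i]]_m) : set 'rV[R[i]]_m :=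
  [set t | \sum_(j < m) dz j (fun w => (rho w)%:C) z * t 0 j = 0].

(* In R[i], [0 < w] says that w is real and positive. *)
Definition C2_strongly_pseudoconvex_at (R : realType) (m : nat)
    (Omega : set 'rV[R[i]]_m) (xi : 'rV[R[i]]_m) : Prop :=
  exists (U : set 'rV[R[i]]_m) (rho : 'rV[R[i]]_m -> R),
    [/\ open_nbhs xi U /\ Ck_on 2 U rho,
        forall z, U z -> boundary Omega z -> exists v, rdiff rho z v <> 0,
        Omega `&` U = [set z | U z /\ rho z < 0],
        boundary Omega `&` U = [set z | U z /\ rho z = 0] &
        forall t, complex_tangent rho xi t -> t <> 0 ->
          0 < levi_form rho xi t].

(* Main.v *)
Require Import Defs.
From mathcomp Require Import all_boot all_order all_algebra.
From mathcomp Require Import complex ring lra.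
From mathcomp Require Import all_classical all_reals all_analysis.
Set Implicit Arguments.
Unset Strict Implicit.
Unset Printing Implicit Defensive.
Import Order.TTheory GRing.Theory Num.Theory.
Import numFieldNormedType.Exports.
Local Open Scope classical_set_scope.
Local Open Scope ring_scope.
Local Open Scope complex_scope.

(** Near [xi0], Taylor's formula and the normalisation of the gradient and of
    the Levi form give linear coordinates [y = (y_0, y')] centred at [z] with
      rho(z + y) = rho(z) + 2 Re L(y) + |y'|^2 + O(|L|^2) + o(|y'|^2),
    where [L = y_0 + small] is a quadratic polynomial in [y].  With
    [tau = - rho(z)], the domain looks like [2 Re L + |y'|^2 < tau], which the map
      (L, y') |-> (L, sqrt tau * y') / (tau - L)
    sends onto the unit ball, [z] going to [0].  Composed with [mu = 1 - e] times
    this map, the quadratic coordinates embed the whole of [Omega `&` U0] into the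
    ball: close to [z] by Taylor's formula, and elsewhere because there [|L|] is
    bounded below, so that [|L|^2 / tau] dominates.  For [z] close to [xi0] the
    image contains the ball of radius [(1 - e) * mu]. *)

(** The order of the quantifiers shapes the proof: [V] is fixed before [e], while the embedding must
    be holomorphic and injective on all of [Omega] [&] [U0], not only near [z]. Quadratic
    polynomials are defined everywhere and injective on a ball whose size does not depend on [e];
    far from [z] only a Taylor estimate with the fixed constant 1/2 is at hand. The map onto the
    ball comes from the identity |tau - L|^2 - |L|^2 - tau |y'|^2 = tau (tau - 2 Re L - |y'|^2). The
    same expansion, with the factor mu, shows that the pole L = tau is never met. The Levi form is
    positive only on the complex tangent space, so the normal direction contributes a term of
    unknown sign. It is charged to |L|^2 with a constant [K] independent of [e]; mu < 1 yields a
    gain (1 - mu^2) |L|^2 / tau, which beats K |L|^2 once tau is small. With mere C^2 regularity the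
    second order part is frozen at [xi], so only the gradient moves with [z]. One factor 1 - e
    pushes the image into the ball, the other leaves room for the errors when a ball is fitted into
    the image. *)

Local Notation normc := Normc.normc.

(** * The real-valued modulus on the complex numbers *)

Section Modulus.
Variable R : realType.
Implicit Types x y : R[i].

Lemma normc_ge0 x : 0 <= normc x.
Proof. by case: x => a b; rewrite /= sqrtr_ge0. Qed.

Lemma ler_normcB x y : normc (x - y) <= normc x + normc y.
Proof. by rewrite -(normcN y) le_normcD. Qed.

Lemma sqr_normc_ReIm x : normc x ^+ 2 = complex.Re x ^+ 2 + complex.Im x ^+ 2.
Proof. by case: x => a b; rewrite /= sqr_sqrtr// addr_ge0 ?sqr_ge0. Qed.

Lemma ler_Re_normc x : `|complex.Re x| <= normc x.
Proof.
case: x => a b /=; rewrite -sqrtr_sqr ler_wsqrtr// lerDl; exact: sqr_ge0.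
Qed.

Lemma ler_Im_normc x : `|complex.Im x| <= normc x.
Proof.
case: x => a b /=; rewrite -sqrtr_sqr ler_wsqrtr// lerDr; exact: sqr_ge0.
Qed.

Lemma normc_real (a : R) : normc a%:C = `|a|.
Proof. by rewrite /= expr0n/= addr0 sqrtr_sqr. Qed.

Lemma ler_normc_sum (I : Type) (r : seq I) (P : pred I) (F : I -> R[i]) :
  normc (\sum_(i <- r | P i) F i) <= \sum_(i <- r | P i) normc (F i).
Proof.
elim/big_ind2: _ => [|x a y b xa yb|//]; first by rewrite Normc.normc0.
by apply: (le_trans (le_normcD _ _)); rewrite lerD.
Qed.

End Modulus.

(** * The l^1 norm on C^m *)

Section RowNorm.
Variables (R : realType) (m : nat).
Implicit Types h k : 'rV[R[i]]_m.

(** Real-valued, so that estimates stay in the ordered field [R]; a sum of moduli passes easily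
    through matrix products. *)
Definition norm1 h : R := \sum_j normc (h 0 j).

Lemma norm1_ge0 h : 0 <= norm1 h.
Proof. by apply: sumr_ge0 => j _; exact: normc_ge0. Qed.

Lemma norm1D h k : norm1 (h + k) <= norm1 h + norm1 k.
Proof.
by rewrite /norm1 -big_split ler_sum// => j _; rewrite mxE le_normcD.
Qed.

Lemma norm1Z (a : R[i]) h : norm1 (a *: h) = normc a * norm1 h.
Proof.
by rewrite /norm1 mulr_sumr; apply: eq_bigr => j _; rewrite mxE Normc.normcM.
Qed.

Lemma norm1N h : norm1 (- h) = norm1 h.
Proof. by apply: eq_bigr => j _; rewrite mxE normcN. Qed.

Lemma norm1_coord h j : normc (h 0 j) <= norm1 h.
Proof.
rewrite /norm1 (bigD1 j)//= lerDl; apply: sumr_ge0 => k _; exact: normc_ge0.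
Qed.

Lemma nbhs_norm1P h (U : set 'rV[R[i]]_m) :
  nbhs h U <-> exists2 r : R, 0 < r & forall k, norm1 (k - h) < r -> U k.
Proof.
split=> [/nbhs_ballP[/= e e0 eU]|[r r0 rU]].
  have eE : e = (complex.Re e)%:C by case: e e0 {eU} => a b /=; case/andP => /eqP ->.
  exists (complex.Re e); first by rewrite -ltcR -eE.
  move=> k hk; apply: eU; split=> [//|i j]; rewrite -ball_normE/= ord1.
  change ((normc (h 0 j - k 0 j))%:C < e); rewrite eE ltcR -normcN opprB.
  apply: le_lt_trans hk; apply: le_trans (norm1_coord _ j).
  by rewrite !mxE.
have m0 : 0 < (m.+1)%:R :> R by rewrite ltr0n.
(* Dividing by m + 1 covers the case m = 0 and makes the sum of m coordinates strictly smaller than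
   [r]. *)
apply/nbhs_ballP; exists (r / m.+1%:R)%:C => /=; first by rewrite ltcR divr_gt0.
move=> k hk; apply: rU.
have le j : normc ((k - h) 0 j) <= r / m.+1%:R.
  have := hk.2 0 j; rewrite -ball_normE/= => H; apply: ltW; rewrite -ltcR.
  by apply: le_lt_trans H; rewrite -normcN !mxE opprB.
have := @ler_sum _ _ (index_enum 'I_m) predT _ _ (fun j _ => le j).
rewrite sumr_const card_ord -[X in X <= _]/(norm1 _) => /le_lt_trans; apply.
rewrite -[_ *+ m]mulr_natl mulrCA gtr_pMr// ltr_pdivrMr// mul1r ltr_nat.
exact: ltnSn.
Qed.

End RowNorm.

(** * Real differentials on C^m in the basis e_k, i e_k *)

Section RealLinear.
Variables (R : realType) (m : nat).
Implicit Types (f : 'rV[R[i]]_m -> R) (z h : 'rV[R[i]]_m).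

Lemma to_realK : cancel (@to_real R m) (@of_real R m).
Proof.
move=> z; apply/rowP => j; rewrite mxE /to_real row_mxEl row_mxEr !mxE.
by case: (z 0 j).
Qed.

Lemma to_real_continuous : continuous (@to_real R m).
Proof.
move=> z V /nbhs_ballP[e /= e0 eV]; apply/nbhs_norm1P; exists e => // w wz.
apply: eV; split=> // i j; rewrite -ball_normE/= ord1.
have le (k : 'I_m) := le_lt_trans (norm1_coord (w - z) k) wz.
case: (split_ordP j) => k ->; rewrite /to_real ?(row_mxEl, row_mxEr) !mxE.
- have := ler_Re_normc ((w - z) 0 k); rewrite !mxE raddfB/= distrC.
  by move=> /le_lt_trans; apply; have := le k; rewrite !mxE.
- have := ler_Im_normc ((w - z) 0 k); rewrite !mxE raddfB/= distrC.
  by move=> /le_lt_trans; apply; have := le k; rewrite !mxE.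
Qed.

Lemma to_real_is_linear (a : R) h k :
  to_real (a%:C *: h + k) = a *: to_real h + to_real k.
Proof.
rewrite /to_real scale_row_mx add_row_mx; congr row_mx;
  apply/rowP => j; rewrite !mxE; case: (h 0 j) => x y; case: (k 0 j) => u v /=;
  by rewrite !mul0r ?subr0 ?addr0.
Qed.

Lemma rdiff_linear f z (a : R) h k :
  rdiff f z (a%:C *: h + k) = a * rdiff f z h + rdiff f z k.
Proof. by rewrite /rdiff to_real_is_linear linearP. Qed.

Lemma rdiff0 f z : rdiff f z 0 = 0.
Proof.
by have /eqP := rdiff_linear f z 1 0 0; rewrite scaler0 addr0 mul1r -[X in X == _]addr0
  (inj_eq (addrI _)) => /eqP.
Qed.

Lemma rdiff_comb (I : Type) (s : seq I) (x : I -> R) (E : I -> 'rV[R[i]]_m) f z :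
  rdiff f z (\sum_(a <- s) (x a)%:C *: E a) = \sum_(a <- s) x a * rdiff f z (E a).
Proof.
elim: s => [|a s IH]; first by rewrite !big_nil rdiff0.
by rewrite !big_cons rdiff_linear IH.
Qed.

Lemma is_derive_line f z h (t : R) : rdifferentiable f (z + t%:C *: h) ->
  is_derive t (1 : R) (fun t : R => f (z + t%:C *: h)) (rdiff f (z + t%:C *: h) h).
Proof.
rewrite /rdifferentiable /rdiff => df.
set g := fun t : R => to_real z + t *: to_real h.
have gE s : to_real (z + s%:C *: h) = g s.
  by rewrite addrC to_real_is_linear addrC.
have -> : (fun t : R => f (z + t%:C *: h)) = (f \o @of_real R m) \o g.
  by apply/funext => s; rewrite /= -gE to_realK.
rewrite gE in df *.
have dg : is_diff t g (0 + *:%R^~ (to_real h)) by apply: is_diffD.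
have d1 : is_diff (g t) (f \o @of_real R m) ('d (f \o @of_real R m) (g t)).
  exact: DiffDef.
have d2 := is_diff_comp dg d1.
have d3 : differentiable ((f \o @of_real R m) \o g) t by exact: (@ex_diff _ _ _ _ _ _ _ d2).
apply: DeriveDef; first exact: diff_derivable.
rewrite deriveE// (@diff_val _ _ _ _ _ _ _ d2).
by rewrite [LHS]/= !fctE add0r scale1r.
Qed.

(* The real basis e_k, i e_k of C^m. *)
Definition rbasis (a : bool * 'I_m) : 'rV[R[i]]_m :=
  (if a.1 then 'i else 1) *: delta_mx 0 a.2.

Definition rcoord h (a : bool * 'I_m) : R :=
  if a.1 then complex.Im (h 0 a.2) else complex.Re (h 0 a.2).

Lemma big_bool_pair (V : nmodType) (F : bool * 'I_m -> V) :
  \sum_a F a = \sum_j (F (true, j) + F (false, j)).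
Proof.
rewrite (eq_bigr (fun a => F (a.1, a.2))); last by case.
rewrite -(pair_bigA _ (fun b j => F (b, j)))/= big_bool/= big_split //.
Qed.

Lemma rcoordE h : h = \sum_a (rcoord h a)%:C *: rbasis a.
Proof.
rewrite big_bool_pair /rcoord /rbasis /= [LHS]row_sum_delta.
apply: eq_bigr => j _; rewrite !scalerA -scalerDl; congr (_ *: _).
case: (h 0 j) => a b; apply/eqP; rewrite eq_complex /=.
by rewrite !(mul0r, mulr0, mulr1, subr0, addr0, oppr0, add0r) !eqxx.
Qed.

Lemma rdiffE f z h : rdiff f z h = \sum_a rcoord h a * rdiff f z (rbasis a).
Proof. by rewrite {1}(rcoordE h) rdiff_comb. Qed.

Lemma sum_rcoord_le h : \sum_a `|rcoord h a| <= 2 * norm1 h.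
Proof.
rewrite big_bool_pair /norm1 mulr_sumr; apply: ler_sum => j _.
by rewrite mulr_natl mulr2n lerD// /rcoord/= ?ler_Im_normc ?ler_Re_normc.
Qed.

Lemma rdifferentiable_continuous f z : rdifferentiable f z -> {for z, continuous f}.
Proof.
move=> /differentiable_continuous df.
have -> : f = (f \o @of_real R m) \o @to_real R m.
  by apply/funext => w; rewrite /= to_realK.
exact: continuous_comp (@to_real_continuous z) df.
Qed.

End RealLinear.

(** * Taylor's formula of order two, uniform in the centre *)

Lemma taylor2_real (R : realType) (f g g' : R -> R) (S e : R) :
  (forall t : R, 0 <= t <= 1 -> is_derive t (1 : R) f (g t)) ->
  (forall t : R, 0 <= t <= 1 -> is_derive t (1 : R) g (g' t)) ->
  (forall t : R, 0 <= t <= 1 -> `|g' t - S| <= e) ->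
  `|f 1 - f 0 - g 0 - 2^-1 * S| <= e.
Proof.
move=> df dg g'S.
(* The quadratic polynomial with second derivative [S] is subtracted. Since psi' = chi - chi 0, the
   mean value theorem for [psi] and then for [chi] leaves one value of [g' - S]. *)
pose psi := f - (g 0 \*: (id : R -> R) + (S / 2) \*: ((id : R -> R) * id)).
pose chi := g - S \*: (id : R -> R).
have dpsi (t : R) : 0 <= t <= 1 -> is_derive t (1 : R) psi (chi t - g 0).
  move=> t01; have d1 := df t t01.
  have d2 := is_deriveB d1 (is_deriveD (is_deriveZ (g 0) (is_derive_id t (1 : R)))
     (is_deriveZ (S / 2) (is_deriveM (is_derive_id t (1 : R)) (is_derive_id t (1 : R))))).
  by apply: (is_derive_eq d2); rewrite /chi !fctE/= /GRing.scale/=; field.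
have dchi (t : R) : 0 <= t <= 1 -> is_derive t (1 : R) chi (g' t - S).
  move=> t01; have d1 := dg t t01.
  have d2 := is_deriveB d1 (is_deriveZ S (is_derive_id t (1 : R))).
  by apply: (is_derive_eq d2); rewrite /GRing.scale/= mulr1.
have cont (h dh : R -> R) (a b : R) : 0 <= a -> b <= 1 ->
    (forall t : R, 0 <= t <= 1 -> is_derive t (1 : R) h (dh t)) ->
    {within `[a, b], continuous h}.
  move=> a0 b1 dh_; apply: derivable_within_continuous => t.
  rewrite in_itv/= => /andP[at_ tb].
  by have [] := dh_ t; rewrite ?(le_trans a0)//= (le_trans tb).
have [c c01 Ec] : exists2 c : R, c \in `[0, 1] &
    psi 1 - psi 0 = (chi c - g 0) * (1 - 0).
  apply: (@MVT_segment _ _ (fun t => chi t - g 0)) => //; last exact: cont dpsi.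
  by move=> t; rewrite in_itv/= => /andP[/ltW t0 /ltW t1]; apply: dpsi; rewrite t0.
have /andP[c0 c1] : 0 <= c <= 1 by move: c01; rewrite in_itv.
have [d d01 Ed] : exists2 d : R, d \in `[0, c] &
    chi c - chi 0 = (g' d - S) * (c - 0).
  apply: (@MVT_segment _ _ (fun t => g' t - S)) => //; last exact: cont dchi.
  move=> t; rewrite in_itv/= => /andP[/ltW t0 /ltW tc]; apply: dchi.
  by rewrite t0 (le_trans tc).
have dS : `|g' d - S| <= e.
  by apply: g'S; move: d01; rewrite in_itv/= => /andP[-> /le_trans ->].
have -> : f 1 - f 0 - g 0 - 2^-1 * S = psi 1 - psi 0.
  by rewrite /psi !fctE/= /GRing.scale/=; field.
have chi0 : chi 0 = g 0 by rewrite /chi !fctE/= /GRing.scale/= mulr0 subr0.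
by rewrite Ec -chi0 Ed !subr0 mulr1 normrM (ger0_norm c0) (le_trans _ dS)// ler_piMr.
Qed.

Lemma is_derive_bigsum (R : realType) (I : Type) (s : seq I) (f : I -> R -> R)
    (df : I -> R) (t : R) :
  (forall a, is_derive t (1 : R) (f a) (df a)) ->
  is_derive t (1 : R) (\sum_(a <- s) f a) (\sum_(a <- s) df a).
Proof.
move=> d; elim: s => [|a s IH]; first by rewrite !big_nil; exact: is_derive_cst.
by rewrite !big_cons; apply: is_deriveD.
Qed.

Section Taylor.
Local Opaque rdiff.

Variables (R : realType) (m : nat).
Variables (U : set 'rV[R[i]]_m) (rho : 'rV[R[i]]_m -> R) (xi : 'rV[R[i]]_m).
Hypotheses (Uxi : nbhs xi U) (C2 : Ck_on 2 U rho).

Let I := (bool * 'I_m)%type.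
Local Notation D a := (fun z => rdiff rho z (rbasis R a)).
Local Notation H a b z := (rdiff (D a) z (rbasis R b)).

Lemma hessian_continuous (a b : I) : {for xi, continuous (fun z => H a b z)}.
Proof.
by case: C2 => _ /(_ (rbasis R a)) [_ /(_ (rbasis R b))] /=; apply; exact: nbhs_singleton.
Qed.

Lemma Ck_on_grad_diff (a : I) z : U z -> rdifferentiable (D a) z.
Proof. by case: C2 => _ /(_ (rbasis R a)) [+ _] => /[apply]. Qed.

Lemma grad_continuous (a : I) : {for xi, continuous (D a)}.
Proof. exact: rdifferentiable_continuous (Ck_on_grad_diff a (nbhs_singleton Uxi)). Qed.

(** The Hessian stays at [xi] while the centre [z] moves: continuity of the second derivatives at
    [xi] controls them on the whole segment from [z] to [z + h], which remains in the ball by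
    convexity. *)
Lemma taylor2 (eps : R) : 0 < eps -> exists2 r : R, 0 < r &
  forall z h, norm1 (z - xi) < r -> norm1 (z + h - xi) < r ->
  `|rho (z + h) - rho z - \sum_a rcoord h a * D a z
    - 2^-1 * \sum_a \sum_b rcoord h a * rcoord h b * H a b xi| <= eps * norm1 h ^+ 2.
Proof.
move=> eps0.
(* The 4 is the square of the 2 in [sum_rcoord_le]. *)
have e40 : 0 < eps / 4 by rewrite divr_gt0.
have /nbhs_norm1P[r r0 rP] : nbhs xi [set z | U z /\
    forall a b : I, `|H a b xi - H a b z| < eps / 4].
  apply: filterI => //.
  have : \forall z \near xi, forall ab : I * I, ab \in enum {: I * I} ->
     `|H ab.1 ab.2 xi - H ab.1 ab.2 z| < eps / 4.
    elim: (enum _) => [|ab s IH].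
      apply: (@filterS _ (nbhs xi) _ setT) => [z _ ab|]; last exact: filterT.
      by rewrite in_nil.
    have /cvgrPdist_lt/(_ _ e40) := hessian_continuous (a := ab.1) (b := ab.2).
    move: IH; apply: filterS2 => z IH Hab c.
    by rewrite in_cons => /orP[/eqP ->//|]; exact: IH.
  by apply: filterS => z + a b => /(_ (a, b)); apply; rewrite mem_enum.
exists r => // z h zr zhr.
set S := \sum_a \sum_b _.
have seg (t : R) : 0 <= t <= 1 -> norm1 (z + t%:C *: h - xi) < r.
  move=> /andP[t0 t1].
  have -> : z + t%:C *: h - xi = (1 - t)%:C *: (z - xi) + t%:C *: (z + h - xi).
    by apply/rowP => j; rewrite rmorphB rmorph1 !mxE; ring.
  apply: le_lt_trans (norm1D _ _) _; rewrite !norm1Z !normc_real.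
  rewrite !ger0_norm ?subr_ge0//.
  have [->|tn0] := eqVneq t 0; first by rewrite mul0r addr0 subr0 mul1r.
  have tp : 0 < t by rewrite lt_def tn0.
  have := norm1_ge0 (z - xi).
  nra.
have := @taylor2_real R (fun t : R => rho (z + t%:C *: h))
  (fun t : R => \sum_a rcoord h a * D a (z + t%:C *: h))
  (fun t : R => \sum_a rcoord h a * \sum_b rcoord h b * H a b (z + t%:C *: h)) S
  (eps * norm1 h ^+ 2).
rewrite !scale0r !scale1r !addr0; apply.
- by move=> t /seg/rP[Uz _]; rewrite -rdiffE; exact: is_derive_line (proj1 C2 _ Uz).
- move=> t /seg/rP[Uz _].
  have -> : (fun t : R => \sum_a rcoord h a * D a (z + t%:C *: h)) =
      \sum_a (rcoord h a \*: (fun t : R => D a (z + t%:C *: h))).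
    by apply/funext => s; rewrite fct_sumE.
  apply: is_derive_bigsum => a; rewrite -rdiffE.
  exact: is_deriveZ (is_derive_line (Ck_on_grad_diff a Uz)).
move=> t t01.
have -> : \sum_a rcoord h a * \sum_b rcoord h b * H a b (z + t%:C *: h) - S =
  \sum_a \sum_b rcoord h a * rcoord h b * (H a b (z + t%:C *: h) - H a b xi).
  rewrite /S -sumrB; apply: eq_bigr => a _; rewrite mulr_sumr -sumrB.
  by apply: eq_bigr => b _; rewrite mulrBr mulrA.
have [_ Hd] := rP _ (seg _ t01).
apply: (@le_trans _ _ (eps / 4 * (2 * norm1 h) ^+ 2)); last by rewrite exprMn; lra.
apply: le_trans (ler_norm_sum _ _ _) _.
apply: (@le_trans _ _ (\sum_a \sum_b `|rcoord h a| * `|rcoord h b| * (eps / 4))).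
  apply: ler_sum => a _; apply: le_trans (ler_norm_sum _ _ _) _.
  apply: ler_sum => b _; rewrite !normrM ler_wpM2l ?mulr_ge0//.
  by rewrite distrC ltW.
have -> : \sum_a \sum_b `|rcoord h a| * `|rcoord h b| * (eps / 4) =
   eps / 4 * (\sum_a `|rcoord h a|) ^+ 2.
  rewrite expr2 mulrCA mulr_suml; apply: eq_bigr => a _.
  by rewrite !mulr_sumr; apply: eq_bigr => b _; ring.
rewrite ler_wpM2l ?(ltW e40)// ler_pXn2r ?nnegrE ?sum_rcoord_le ?mulr_ge0 ?norm1_ge0//.
by apply: sumr_ge0.
Qed.

End Taylor.

Lemma normc_le_ReIm (R : realType) (x : R[i]) :
  normc x <= `|complex.Re x| + `|complex.Im x|.
Proof.
rewrite -(@ler_pXn2r _ 2) ?nnegrE ?normc_ge0 ?addr_ge0//.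
rewrite sqr_normc_ReIm sqrrD !real_normK ?num_real//.
by rewrite lerD2r lerDl mulrn_wge0// mulr_ge0.
Qed.

(** * Taylor's formula in terms of the complex gradient, the (2,0) part and the Levi form *)

Section ComplexTaylor.
Variables (R : realType) (m : nat).
Variables (U : set 'rV[R[i]]_m) (rho : 'rV[R[i]]_m -> R) (xi : 'rV[R[i]]_m).
Hypotheses (Uxi : nbhs xi U) (C2 : Ck_on 2 U rho).

Local Notation D a := (fun z => rdiff rho z (rbasis R a)).
Local Notation H a b z := (rdiff (D a) z (rbasis R b)).

Lemma rdiff_cst (c : R) (z v : 'rV[R[i]]_m) : rdiff (fun _ => c) z v = 0.
Proof. by rewrite /rdiff (_ : _ \o _ = cst c)// diff_cst. Qed.

Lemma rdiff_scale (c : R) f (z v : 'rV[R[i]]_m) : rdifferentiable f z ->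
  rdiff (fun w => c * f w) z v = c * rdiff f z v.
Proof.
by move=> df; rewrite /rdiff (_ : _ \o _ = c \*: (f \o @of_real R m))// diffZ.
Qed.

Local Opaque rdiff.

Definition cgrad z : 'cV[R[i]]_m := \col_j dz j (fun w => (rho w)%:C) z.

Lemma rbasis_re j : rbasis R (false, j) = delta_mx 0 j :> 'rV[R[i]]_m.
Proof. by rewrite /rbasis scale1r. Qed.

Lemma rbasis_im j : rbasis R (true, j) = 'i *: delta_mx 0 j :> 'rV[R[i]]_m.
Proof. by []. Qed.

Lemma halfC : (2^-1 : R[i]) = (2^-1)%:C.
Proof. by rewrite fmorphV rmorph_nat. Qed.

Lemma dzE j z : dz j (fun w => (rho w)%:C) z =
  (D (false, j) z / 2) -i* (D (true, j) z / 2).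
Proof.
rewrite /dz /crdiff /= !rdiff_cst halfC.
rewrite -[rdiff (fun w => rho w)]/(rdiff rho) -rbasis_im -rbasis_re.
move: (rdiff rho) => T.
apply/eqP; rewrite eq_complex/=; apply/andP; split; apply/eqP; ring.
Qed.

Lemma dz_half (u v : 'rV[R[i]]_m -> R) j z :
  rdifferentiable u z -> rdifferentiable v z ->
  dz j (fun w => (2^-1 * u w) +i* (2^-1 * v w)) z =
  ((rdiff u z (rbasis R (false, j)) + rdiff v z (rbasis R (true, j))) / 4) +i*
  ((rdiff v z (rbasis R (false, j)) - rdiff u z (rbasis R (true, j))) / 4).
Proof.
move=> du dv; rewrite /dz /crdiff /= (rdiff_scale _ _ du) (rdiff_scale _ _ dv).
rewrite (rdiff_scale _ _ du) (rdiff_scale _ _ dv).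
rewrite halfC -rbasis_im -rbasis_re.
move: (rdiff u) (rdiff v) => T S.
apply/eqP; rewrite eq_complex/=; apply/andP; split; apply/eqP; field => //.
Qed.

Definition hess a b z := H a b z.

Lemma dz_dzbarE j k z : U z ->
  dz j (dzbar k (fun w => (rho w)%:C)) z =
  ((hess (false, k) (false, j) z + hess (true, k) (true, j) z) / 4) +i*
  ((hess (true, k) (false, j) z - hess (false, k) (true, j) z) / 4).
Proof.
move=> Uz.
have -> : dzbar k (fun w => (rho w)%:C) =
   fun w => (2^-1 * D (false, k) w) +i* (2^-1 * D (true, k) w).
  apply/funext => w; rewrite /dzbar /crdiff /= !rdiff_cst halfC.
  rewrite -[rdiff (fun w => rho w)]/(rdiff rho) -rbasis_im -rbasis_re.
  move: (rdiff rho) => T.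
  apply/eqP; rewrite eq_complex/=; apply/andP; split; apply/eqP; ring.
exact: dz_half (Ck_on_grad_diff C2 _ Uz) (Ck_on_grad_diff C2 _ Uz).
Qed.

(* The (2,0) part of half the real Hessian at [xi]; with the Levi form it makes up
   the whole of it, see [hessian_levi]. *)
Definition cquad : 'M[R[i]]_m := \matrix_(j, k)
  (((hess (false, k) (false, j) xi - hess (true, k) (true, j) xi) / 8) -i*
  ((hess (true, k) (false, j) xi + hess (false, k) (true, j) xi) / 8)).

(** As [rho] is real, the (0,1) part of its differential is the conjugate of the (1,0) part. *)
Lemma grad_cgrad (z h : 'rV[R[i]]_m) :
  \sum_a rcoord h a * D a z = 2 * complex.Re ((h *m cgrad z) 0 0).
Proof.
rewrite big_bool_pair !mxE raddf_sum/= mulr_sumr; apply: eq_bigr => j _.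
rewrite mxE dzE /rcoord /=; move: (rdiff rho) => T.
by case: (h 0 j) => a b /=; field.
Qed.

(** The identity holds for each pair (j, k) separately: h_j h_k carries the (2,0) part and h_j times
    the conjugate of h_k the (1,1) part. The real Hessian sees the Levi form through its real
    part. *)
Lemma hessian_levi (h : 'rV[R[i]]_m) :
  2^-1 * \sum_a \sum_b rcoord h a * rcoord h b * hess a b xi =
  2 * complex.Re ((h *m cquad *m h^T) 0 0) + complex.Re (levi_form rho xi h).
Proof.
have Uxi' := nbhs_singleton Uxi.
have -> : levi_form rho xi h = \sum_k \sum_j
    (((hess (false, k) (false, j) xi + hess (true, k) (true, j) xi) / 4) +i*
    ((hess (true, k) (false, j) xi - hess (false, k) (true, j) xi) / 4)) *
     h 0 j * ((h 0 k)^*)%C.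
  rewrite /levi_form exchange_big/=; apply: eq_bigr => k _.
  by apply: eq_bigr => j _; rewrite dz_dzbarE.
rewrite /cquad; move: hess => T.
rewrite [(_ *m h^T) 0 0]mxE.
rewrite big_bool_pair !raddf_sum/= !mulr_sumr -big_split/=; apply: eq_bigr => k _.
rewrite !big_bool_pair mxE mulr_suml !raddf_sum/= !mulr_sumr -!big_split/= mulr_sumr.
apply: eq_bigr => j _.
rewrite !mxE /rcoord/=.
case: (h 0 j) => a b; case: (h 0 k) => c d /=.
by field.
Qed.

Lemma complex_taylor (eps : R) : 0 < eps -> exists2 r : R, 0 < r &
  forall z h, norm1 (z - xi) < r -> norm1 (z + h - xi) < r ->
  `|rho (z + h) - rho z
    - 2 * complex.Re ((h *m cgrad z + h *m cquad *m h^T) 0 0)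
    - complex.Re (levi_form rho xi h)| <= eps * norm1 h ^+ 2.
Proof.
move=> /(taylor2 Uxi C2)[r r0 H]; exists r => // z h zr zhr.
have combine (e a u v x y w : R) : `|a - u - v| <= e -> u = 2 * x ->
    v = 2 * y + w -> `|a - 2 * (x + y) - w| <= e.
  by move=> H1 E1 E2; move: H1; rewrite E1 E2; congr (`|_| <= _); ring.
rewrite [(h *m _ + _) 0 0]mxE raddfD/=.
exact: (combine _ _ _ _ _ _ _ (H z h zr zhr) (grad_cgrad z h) (hessian_levi h)).
Qed.

Lemma cgrad_near (eps : R) : 0 < eps -> exists2 r : R, 0 < r &
  forall z j, norm1 (z - xi) < r -> normc ((cgrad z - cgrad xi) j 0) <= eps.
Proof.
move=> eps0.
suff [r r0 H] : exists2 r : R, 0 < r &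
  forall z, norm1 (z - xi) < r -> forall a, a \in enum {: bool * 'I_m} ->
   `|D a xi - D a z| < eps.
  exists r => // z j zr; rewrite !mxE !dzE.
  have H1 := H z zr (false, j) (mem_enum _ _).
  have H2 := H z zr (true, j) (mem_enum _ _).
  move: (rdiff rho) H1 H2 => T; rewrite !ltr_norml => /andP[H1 H1'] /andP[H2 H2'].
  apply: le_trans (normc_le_ReIm _) _ => /=.
  apply: (@le_trans _ _ (eps / 2 + eps / 2)); last lra.
  by apply: lerD; rewrite ler_norml; apply/andP; split; lra.
elim: (enum _) => [|a s [r r0 IH]]; first by exists 1.
have /cvgrPdist_lt/(_ _ eps0)/nbhs_norm1P[r' r'0 H] := grad_continuous Uxi C2 (a := a).
exists (Num.min r r') => [|z]; first by rewrite lt_min r0.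
rewrite lt_min => /andP[zr zr'] b; rewrite in_cons => /orP[/eqP ->|].
  exact: H.
exact: IH.
Qed.

Lemma cgrad_neq0 v : rdiff rho xi v <> 0 -> cgrad xi != 0.
Proof.
move=> v0; apply/eqP => g0; apply: v0.
by rewrite rdiffE grad_cgrad g0 mulmx0 mxE mulr0.
Qed.

End ComplexTaylor.

(** * Congruence of Hermitian matrices, and a normal form relative to a hyperplane *)

Section HermitianNormalForm.
Variable R : realType.
Local Notation C := R[i].

Definition adjmx m n (A : 'M[C]_(m, n)) : 'M[C]_(n, m) := (map_mx (@conjc R) A)^T.

Lemma adjmxM m n p (A : 'M[C]_(m, n)) (B : 'M[C]_(n, p)) :
  adjmx (A *m B) = adjmx B *m adjmx A.
Proof. by rewrite /adjmx map_mxM trmx_mul. Qed.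

Lemma adjmxK m n (A : 'M[C]_(m, n)) : adjmx (adjmx A) = A.
Proof. by apply/matrixP => i j; rewrite !mxE conjcK. Qed.

Lemma adjmx1 n : adjmx (1%:M : 'M[C]_n) = 1%:M.
Proof. by rewrite /adjmx map_mx1 trmx1. Qed.

Lemma adjmx_block m1 m2 n1 n2 (A : 'M[C]_(m1, n1)) (B : 'M[C]_(m1, n2))
    (A' : 'M[C]_(m2, n1)) (B' : 'M[C]_(m2, n2)) :
  adjmx (block_mx A B A' B') = block_mx (adjmx A) (adjmx A') (adjmx B) (adjmx B').
Proof. by rewrite /adjmx map_block_mx tr_block_mx. Qed.

Lemma adjmx_row m n1 n2 (A : 'M[C]_(m, n1)) (B : 'M[C]_(m, n2)) :
  adjmx (row_mx A B) = col_mx (adjmx A) (adjmx B).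
Proof. by rewrite /adjmx map_row_mx tr_row_mx. Qed.

Lemma adjmxD m n (A B : 'M[C]_(m, n)) : adjmx (A + B) = adjmx A + adjmx B.
Proof. by rewrite /adjmx map_mxD raddfD. Qed.

Lemma adjmxN m n (A : 'M[C]_(m, n)) : adjmx (- A) = - adjmx A.
Proof. by rewrite /adjmx map_mxN raddfN. Qed.

Lemma adjmx0 m n : adjmx (0 : 'M[C]_(m, n)) = 0.
Proof. by rewrite /adjmx map_mx0 trmx0. Qed.

Lemma herm_block m n (A : 'M[C]_(m + n)) : adjmx A = A ->
  [/\ adjmx (ulsubmx A) = ulsubmx A, adjmx (dlsubmx A) = ursubmx A,
      adjmx (ursubmx A) = dlsubmx A & adjmx (drsubmx A) = drsubmx A].
Proof.
move=> Ah; have : adjmx (block_mx (ulsubmx A) (ursubmx A) (dlsubmx A) (drsubmx A)) =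
  block_mx (ulsubmx A) (ursubmx A) (dlsubmx A) (drsubmx A) by rewrite submxK.
by rewrite adjmx_block => /eq_block_mx[].
Qed.

Definition posdef n (A : 'M[C]_n) : Prop :=
  adjmx A = A /\ forall t : 'rV_n, t != 0 -> 0 < (t *m A *m adjmx t) 0 0.

(** [d] is the Schur complement of the lower right block. No sign is claimed for it, so that the
    lemma serves both the positive definite case and the Levi form, which is positive only on a
    hyperplane. *)
Lemma schur_complement n (A : 'M[C]_(1 + n)) (Q : 'M[C]_n) :
  adjmx A = A -> Q *m drsubmx A *m adjmx Q = 1%:M ->
  exists (x : 'rV[C]_n) (d : 'M[C]_1), let P := block_mx 1%:M x 0 Q in
    [/\ P \in unitmx, adjmx d = d & P *m A *m adjmx P = block_mx d 0 0 1%:M].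
Proof.
move=> Ah QA.
have [Qu Qu'] : Q \in unitmx /\ adjmx Q \in unitmx.
  by split; [case/mulmx1_unit: QA; rewrite unitmx_mul => /andP[]|case/mulmx1_unit: QA].
set A' := drsubmx A; set r := ursubmx A; set a := ulsubmx A.
have [ah _ rh A'h] := herm_block Ah.
rewrite -/a -/r -/A' in ah rh A'h.
have AE : A = block_mx a r (adjmx r) A' by rewrite rh submxK.
have WA : adjmx Q *m Q *m A' = 1%:M.
  by rewrite -mulmxA; apply: mulmx1C.
(* By [WA], [adjmx Q *m Q] is the inverse of [A']; this [x] clears the off-diagonal blocks. *)
pose x := - r *m (adjmx Q *m Q).
have xA : r + x *m A' = 0 by rewrite /x mulNmx mulNmx -mulmxA WA mulmx1 subrr.
have xA' : adjmx r + A' *m adjmx x = 0.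
  by rewrite -A'h -adjmxM -adjmxD xA adjmx0.
exists x, (a + x *m adjmx r); split.
- by rewrite unitmxE det_ublock det1 mul1r -unitmxE.
- rewrite adjmxD ah adjmxM adjmxK; congr (_ + _).
  have -> : r = - (x *m A') by apply/eqP; rewrite -addr_eq0 xA.
  by rewrite adjmxN adjmxM A'h mulNmx mulmxN mulmxA.
rewrite AE adjmx_block adjmx1 adjmx0 !mulmx_block !mul1mx !mulmx1 !mul0mx !mulmx0.
rewrite xA !mul0mx !add0r ?addr0; congr block_mx => //.
by rewrite -mulmxA -mulmxDr xA' mulmx0.
Qed.

(** Positivity is asked on vectors with vanishing first entry, which is what strong pseudoconvexity
    gives once the complex tangent space is the hyperplane y_0 = 0. *)
Lemma posdef_sub n (A : 'M[C]_(1 + n)) : adjmx A = A ->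
  (forall t : 'rV_n, t != 0 -> 0 < (row_mx 0 t *m A *m adjmx (row_mx (0 : 'rV_1) t)) 0 0) ->
  posdef (drsubmx A).
Proof.
move=> Ah Apos; split; first by have [] := herm_block Ah.
move=> t /Apos; rewrite -{1}(submxK A) adjmx_row adjmx0 mul_row_block !mul0mx !add0r.
by rewrite mul_row_col mulmx0 add0r.
Qed.

Lemma posdef_conj n (A : 'M[C]_n) (P : 'M[C]_n) :
  P \in unitmx -> posdef A -> posdef (P *m A *m adjmx P).
Proof.
move=> Pu [Ah Ap]; split; first by rewrite !adjmxM adjmxK Ah mulmxA.
move=> t t0; have := Ap (t *m P); rewrite adjmxM !mulmxA; apply.
by apply: contra t0 => /eqP tP; rewrite -(mulmxK Pu t) tP mul0mx.
Qed.

Lemma cholesky_step n (A : 'M[C]_(1 + n)) :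
  (forall A' : 'M[C]_n, posdef A' ->
    exists2 Q : 'M[C]_n, Q \in unitmx & Q *m A' *m adjmx Q = 1%:M) ->
  posdef A -> exists2 P : 'M[C]_(1 + n), P \in unitmx & P *m A *m adjmx P = 1%:M.
Proof.
move=> IH pA; have Ah := pA.1.
have [|Q Qu QA] := IH (drsubmx A).
  apply: posdef_sub => // t t0; apply: pA.2.
  by apply: contra t0 => /eqP/(congr1 (@rsubmx C 1 1 n)); rewrite row_mxKr linear0 => ->.
have [x [d [Pu dh PA]]] := schur_complement Ah QA.
set P := block_mx _ _ _ _ in Pu PA.
(* [d] is the value of the transformed form on the first basis vector; scaling that vector by 1 /
   sqrt d then normalises it. *)
have d0 : 0 < d 0 0.
  have [_ /(_ (row_mx 1%:M 0))] := posdef_conj Pu pA; rewrite PA.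
  rewrite adjmx_row adjmx0 mul_row_block !mul0mx !mul1mx !addr0.
  rewrite mul_row_col mulmx0 addr0 adjmx1 mulmx1; apply.
  apply/eqP => /(congr1 (@lsubmx C 1 1 n)); rewrite row_mxKl linear0 => /matrixP/(_ 0 0)/eqP.
  by rewrite !mxE oner_eq0.
pose s : R := (Num.sqrt (complex.Re (d 0 0)))^-1.
have dE : d 0 0 = (complex.Re (d 0 0))%:C.
  by case: (d 0 0) d0 => u v /=; case/andP => /eqP ->.
have d0' : 0 < complex.Re (d 0 0) by rewrite -ltcR -dE.
pose S : 'M[C]_(1 + n) := block_mx (s%:C)%:M 0 0 1%:M.
exists (S *m P).
  rewrite unitmx_mul Pu andbT unitmxE /S det_ublock det1 mulr1 det_scalar1 unitfE.
  by rewrite fmorph_eq0 invr_eq0 gt_eqF// sqrtr_gt0.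
rewrite adjmxM mulmxA -(mulmxA S) -(mulmxA S) PA /S adjmx_block !adjmx0 adjmx1.
rewrite !mulmx_block !mulmx0 !mul0mx !mulmx1 !addr0 !add0r scalar_mx_block.
congr block_mx; last by rewrite mul0mx.
apply/matrixP => i j; rewrite !ord1 mul_scalar_mx !mxE big_ord1 !mxE.
have sds : s * complex.Re (d 0 0) * s = 1.
  rewrite /s -[X in _ * X * _](sqr_sqrtr (ltW d0')) expr2 mulrA mulVf ?mul1r ?mulfV//.
    by rewrite gt_eqF// sqrtr_gt0.
  by rewrite gt_eqF// sqrtr_gt0.
rewrite dE /= mulr1n; apply/eqP; rewrite eq_complex/= !(mul0r, mulr0, subr0, addr0, oppr0).
by rewrite sds !eqxx.
Qed.

Lemma cholesky n (A : 'M[C]_n) : posdef A ->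
  exists2 P : 'M[C]_n, P \in unitmx & P *m A *m adjmx P = 1%:M.
Proof.
elim: n A => [|n IH] A; last exact: cholesky_step.
by exists 1%:M; [exact: unitmx1|apply/matrixP => -[]].
Qed.

(** A nonzero column has rank one, so the row factor of its Gaussian elimination is a nonzero scalar
    [c]; the column factor, inverted and divided by [c], does the job. *)
Lemma col_normal n (b : 'cV[C]_n.+1) : b != 0 ->
  exists2 P : 'M[C]_n.+1, P \in unitmx & P *m b = delta_mx 0 0.
Proof.
move=> b0; have r1 : \rank b = 1%N.
  by apply/eqP; rewrite eqn_leq rank_leq_col lt0n mxrank_eq0.
have bE := mulmx_ebase b; rewrite r1 in bE.
set c := row_ebase b 0 0.
have cE : row_ebase b = c%:M by rewrite [LHS]mx11_scalar.
have c0 : c != 0.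
  by have := row_ebase_unit b; rewrite cE unitmxE det_scalar1 unitfE.
exists (c^-1 *: invmx (col_ebase b)).
  by rewrite unitmxZ ?unitmx_inv ?col_ebase_unit ?unitfE ?invr_eq0.
rewrite -[X in _ *m X = _]bE cE -scalemxAl !mulmxA mulVmx ?col_ebase_unit// mul1mx.
rewrite mul_mx_scalar scalerA mulVf// scale1r.
by apply/matrixP => i j; rewrite !mxE !ord1 eqxx andbT; case: i => -[|i] ? .
Qed.

(** [P0] turns the hyperplane t b = 0 into y_0 = 0, where the form is positive definite and can be
    reduced to the identity. The block matrix [P1] from the Schur complement has first column e_0,
    so it keeps the normalisation of [b]. The coefficient [d] of the normal direction can have any
    sign. *)
Lemma levi_normal_form n (A : 'M[C]_n.+1) (b : 'cV[C]_n.+1) :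
  adjmx A = A -> b != 0 ->
  (forall t : 'rV_n.+1, t *m b = 0 -> t != 0 -> 0 < (t *m A *m adjmx t) 0 0) ->
  exists (P : 'M[C]_n.+1) (d : R),
    [/\ P \in unitmx, P *m b = delta_mx 0 0 &
      forall y : 'rV_n.+1, complex.Re (((y *m P) *m A *m adjmx (y *m P)) 0 0) =
        d * normc (y 0 0) ^+ 2 + \sum_j normc (y 0 (lift 0 j)) ^+ 2].
Proof.
move=> Ah b0 Apos.
have [P0 P0u P0b] := col_normal b0.
pose A1 : 'M[C]_(1 + n) := P0 *m A *m adjmx P0.
have A1h : adjmx A1 = A1 by rewrite /A1 !adjmxM adjmxK Ah mulmxA.
have e0E : delta_mx 0 0 = col_mx 1%:M 0 :> 'cV[C]_(1 + n).
  apply/matrixP => k l; rewrite ord1.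
  case: (split_ordP k) => k' ->; first by rewrite col_mxEu !mxE !ord1.
  by rewrite col_mxEd !mxE.
have [|Q Qu QA] := @cholesky n (drsubmx A1).
  apply: posdef_sub => // t t0.
  have := Apos (row_mx (0 : 'rV_1) t *m P0); rewrite -mulmxA P0b e0E.
  rewrite mul_row_col mulmx0 mul0mx addr0 /A1 adjmxM !mulmxA; apply=> //.
  apply: contra t0 => /eqP/(congr1 (mulmx^~ (invmx P0))).
  by rewrite mulmxK// mul0mx => /(congr1 (@rsubmx C 1 1 n)); rewrite row_mxKr linear0 => ->.
have [x [d [Pu dh PA]]] := schur_complement A1h QA.
set P1 := block_mx _ _ _ _ in Pu PA.
exists (P1 *m P0), (complex.Re (d 0 0)); split.
- by rewrite unitmx_mul Pu.
- rewrite -mulmxA P0b e0E.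
  have H : P1 *m col_mx 1%:M 0 = col_mx 1%:M 0.
    by rewrite /P1 mul_block_col !mulmx0 !mul0mx mulmx1 !addr0.
  exact: H.
move=> y.
have -> : y *m (P1 *m P0) *m A *m adjmx (y *m (P1 *m P0)) =
   (y : 'rV_(1 + n)) *m (P1 *m A1 *m adjmx P1) *m adjmx (y : 'rV_(1 + n)).
  by rewrite /A1 !adjmxM !mulmxA.
have dE : d 0 0 = (complex.Re (d 0 0))%:C.
  have := congr1 (fun M : 'M[C]_1 => M 0 0) dh; rewrite !mxE; case: (d 0 0) => u v [] /eqP.
  by rewrite eq_sym -addr_eq0 -mulr2n mulrn_eq0/= => /eqP ->.
have E (u : 'rV[C]_1) (v : 'rV[C]_n) :
  (row_mx u v *m block_mx d 0 0 1%:M *m adjmx (row_mx u v)) 0 0 =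
    d 0 0 * (u 0 0 * (u 0 0)^*%C) + \sum_j v 0 j * (v 0 j)^*%C.
  rewrite mul_row_block !mulmx0 addr0 add0r mulmx1 adjmx_row mul_row_col mxE; congr (_ + _).
    by rewrite !mxE big_ord1 !mxE big_ord1 mulrA (mulrC (d 0 0)).
  by rewrite mxE; apply: eq_bigr => j _; rewrite !mxE.
rewrite PA -{1 2}(hsubmxK (y : 'rV_(1 + n))) E raddfD raddf_sum/=.
have ccE (w : C) : w * w^*%C = (normc w ^+ 2)%:C.
  by rewrite -sqr_normc rmorphXn.
rewrite ccE dE -rmorphM/=; congr (_ * _ ^+ 2 + _).
  by rewrite mxE; congr (normc (y _ _)); apply/val_inj.
apply: eq_bigr => j _; rewrite ccE/= mxE; congr (normc (y _ _) ^+ 2).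
exact/val_inj.
Qed.

End HermitianNormalForm.

(** * Bounds for linear, bilinear and quadratic expressions *)

Section MatrixBounds.
Variable R : realType.
Local Notation C := R[i].

Lemma norm1_mulmx m n (P : 'M[C]_(m, n)) :
  exists2 c : R, 0 < c & forall y : 'rV_m, norm1 (y *m P) <= c * norm1 y.
Proof.
(* The summand 1 keeps the constant positive for the zero matrix. *)
exists (1 + \sum_j \sum_k normc (P k j)) => [|y].
  by rewrite ltr_pwDl// sumr_ge0// => j _; rewrite sumr_ge0// => k _; exact: normc_ge0.
rewrite mulrDl mul1r; apply: le_trans (_ : \sum_j \sum_k normc (P k j) * norm1 y <= _).
  apply: ler_sum => j _; rewrite mxE; apply: le_trans (ler_normc_sum _ _ _) _.
  apply: ler_sum => k _; rewrite Normc.normcM mulrC ler_wpM2l ?normc_ge0//.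
  exact: norm1_coord.
rewrite mulr_suml; under [X in _ <= _ + X]eq_bigr do rewrite mulr_suml.
by rewrite lerDr norm1_ge0.
Qed.

Lemma normc_bilinear m (B : 'M[C]_m) : exists2 c : R, 0 < c &
  forall x y : 'rV_m, normc ((x *m B *m y^T) 0 0) <= c * (norm1 x * norm1 y).
Proof.
have [c c0 cB] := norm1_mulmx B; exists c => // x y.
rewrite mulrA; apply: (@le_trans _ _ (norm1 (x *m B) * norm1 y)); last first.
  by rewrite ler_wpM2r ?norm1_ge0.
rewrite mxE /norm1 mulr_suml; apply: le_trans (ler_normc_sum _ _ _) _.
apply: ler_sum => j _; rewrite Normc.normcM ler_wpM2l ?normc_ge0// mxE.
exact: norm1_coord.
Qed.

Lemma normc_linear m (g : 'cV[C]_m) (e : R) : (forall j, normc (g j 0) <= e) ->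
  forall y : 'rV_m, normc ((y *m g) 0 0) <= e * norm1 y.
Proof.
move=> ge y; rewrite mxE mulr_sumr; apply: le_trans (ler_normc_sum _ _ _) _.
by apply: ler_sum => j _; rewrite Normc.normcM mulrC ler_wpM2r ?normc_ge0.
Qed.

(** The L of the overview: [g] will be the complex gradient at [z] and [B] the (2,0) part of the
    second order term at [xi], both in the coordinates y. *)
Definition qform m (g : 'cV[C]_m) (B : 'M[C]_m) (y : 'rV[C]_m) : C :=
  (y *m g + y *m B *m y^T) 0 0.

Definition tailsq n (y : 'rV[C]_n.+1) : R := \sum_j normc (y 0 (lift 0 j)) ^+ 2.

Lemma tailsq_ge0 n (y : 'rV[C]_n.+1) : 0 <= tailsq y.
Proof. by apply: sumr_ge0 => j _; exact: sqr_ge0. Qed.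

Lemma cauchy_sum (I : Type) (s : seq I) (f : I -> R) :
  (\sum_(j <- s) f j) ^+ 2 <= (size s)%:R * \sum_(j <- s) f j ^+ 2.
Proof.
elim: s => [|a s IH]; first by rewrite !big_nil expr0n mulr0.
rewrite !big_cons /= -[(size s).+1]add1n natrD mulrDl mul1r mulrDr.
have [s0|s0] := eqVneq (size s) 0%N.
  by rewrite s0 (size0nil s0) !big_nil !mul0r !addr0.
have sp : 0 < (size s)%:R :> R by rewrite ltr0n lt0n.
set S := \sum_(j <- s) f j in IH *; set T := \sum_(j <- s) _ in IH *.
set k := (size s)%:R in sp IH *.
(* This is the induction step multiplied by [k], which completes the square and brings in the
   induction hypothesis. *)
have : 0 <= k * (f a ^+ 2 * k + T - 2 * f a * S).
  rewrite (_ : k * _ = (k * f a - S) ^+ 2 + (k * T - S ^+ 2)); last by ring.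
  by rewrite addr_ge0 ?sqr_ge0// subr_ge0.
by rewrite pmulr_rge0// => H; lra.
Qed.

Lemma norm1_sq n (y : 'rV[C]_n.+1) :
  norm1 y ^+ 2 <= n.+1%:R * (normc (y 0 0) ^+ 2 + tailsq y).
Proof.
have := cauchy_sum (enum 'I_n.+1) (fun j => normc (y 0 j)).
by rewrite size_enum_ord !big_enum/= [X in _ <= _ * X -> _]big_ord_recl.
Qed.

End MatrixBounds.

(** * Normal form of the defining function near a strongly pseudoconvex point *)

Section StronglyPseudoconvex.
Variables (R : realType) (n : nat).
Local Notation C := R[i].
Local Notation CV := 'rV[C]_n.+1.
Variables (U : set CV) (rho : CV -> R) (xi : CV).
Hypotheses (Uxi : nbhs xi U) (C2 : Ck_on 2 U rho).
Hypothesis grad_neq0 : cgrad rho xi != 0.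
Hypothesis levi_pos : forall t, complex_tangent rho xi t -> t <> 0 ->
  0 < levi_form rho xi t.

Lemma levi_diag : exists (P : 'M[C]_n.+1) (d : R),
  [/\ P \in unitmx, P *m cgrad rho xi = delta_mx 0 0 &
    forall y : CV, complex.Re (levi_form rho xi (y *m P)) =
       d * normc (y 0 0) ^+ 2 + tailsq y].
Proof.
pose A : 'M[C]_n.+1 := \matrix_(j, k) dz j (dzbar k (fun w => (rho w)%:C)) xi.
have leviE t : levi_form rho xi t = (t *m A *m adjmx t) 0 0.
  rewrite mxE /levi_form exchange_big; apply: eq_bigr => k _.
  rewrite mxE mulr_suml; apply: eq_bigr => j _; rewrite !mxE.
  by rewrite (mulrC (t 0 j)).
(* The Hermitian part of the Levi matrix: its form is the real part of the Levi form, hence positive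
   wherever the Levi form is. *)
pose S := (2^-1 : C) *: (A + adjmx A).
have conj2 : ((2^-1 : C)^*)%C = 2^-1 by rewrite halfC /= oppr0.
have SE t : (t *m S *m adjmx t) 0 0 =
    2^-1 * (levi_form rho xi t + (levi_form rho xi t)^*%C).
  rewrite /S -scalemxAr -scalemxAl mxE mulmxDr mulmxDl mxE leviE; congr (_ * (_ + _)).
  have -> : t *m adjmx A *m adjmx t = adjmx (t *m A *m adjmx t).
    by rewrite !adjmxM adjmxK mulmxA.
  by rewrite !mxE.
have SRe t : (t *m S *m adjmx t) 0 0 = (complex.Re (levi_form rho xi t))%:C.
  rewrite SE halfC; case: (levi_form _ _ _) => u v; apply/eqP; rewrite eq_complex/=.
  by apply/andP; split; apply/eqP; field.
have [|t t0 tn0|P [d [Pu Pb PE]]] := @levi_normal_form R n S (cgrad rho xi) _ grad_neq0.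
- apply/matrixP => j k; rewrite !mxE rmorphM rmorphD.
  rewrite [X in X * _]conj2 [X in _ * (_ + X)]conjcK.
  by rewrite [in LHS]addrC.
- have L0 : 0 < levi_form rho xi t.
    apply: levi_pos; last exact/eqP.
    have := congr1 (fun M : 'M[C]_1 => M 0 0) t0; rewrite !mxE => H.
    by rewrite /complex_tangent/= -[RHS]H; apply: eq_bigr => j _; rewrite mxE mulrC.
  rewrite SRe; move: L0; case: (levi_form _ _ _) => u v /andP[_].
  by rewrite ltcR.
by exists P, d; split => // y; rewrite -PE SRe.
Qed.

Section Coordinates.
Variables (P : 'M[C]_n.+1).
Hypotheses (Pu : P \in unitmx) (Pb : P *m cgrad rho xi = delta_mx 0 0).

Lemma near_small (e : R) : 0 < e -> exists2 r : R, 0 < r & forall z y : CV,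
  norm1 (z - xi) < r -> norm1 (z + y *m P - xi) < r -> norm1 y <= e.
Proof.
move=> e0; have [c c0 cP] := norm1_mulmx (invmx P).
exists (e / c / 2) => [|z y zr zyr]; first by rewrite !divr_gt0.
have -> : y = (y *m P) *m invmx P by rewrite mulmxK.
apply: le_trans (cP _) _; rewrite mulrC -ler_pdivlMr//.
have -> : y *m P = (z + y *m P - xi) - (z - xi).
  by rewrite opprB addrA subrK addrAC subrr add0r.
apply: le_trans (norm1D _ _) _; rewrite norm1N; lra.
Qed.

Lemma grad_coord_near (e : R) : 0 < e -> exists2 r : R, 0 < r & forall z j,
  norm1 (z - xi) < r -> normc ((P *m cgrad rho z - delta_mx 0 0) j 0) <= e.
Proof.
move=> e0; have [c c0 cP] := norm1_mulmx P^T.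
have m0 : 0 < (n.+1)%:R :> R by rewrite ltr0n.
have e'0 : 0 < e / c / n.+1%:R by rewrite !divr_gt0.
have [r r0 rP] := cgrad_near Uxi C2 e'0.
exists r => // z j zr; rewrite -Pb -mulmxBr.
have -> : (P *m (cgrad rho z - cgrad rho xi)) j 0 =
    ((cgrad rho z - cgrad rho xi)^T *m P^T) 0 j by rewrite -trmx_mul [RHS]mxE.
apply: le_trans (norm1_coord _ _) _; apply: le_trans (cP _) _.
rewrite mulrC -ler_pdivlMr//.
apply: le_trans (_ : \sum_(j < n.+1) e / c / n.+1%:R <= _); last first.
  by rewrite sumr_const card_ord -[_ *+ n.+1]mulr_natr divfK// gt_eqF.
by apply: ler_sum => k _; rewrite mxE; exact: rP.
Qed.

(* The coordinate [y_0] is controlled by [L] and [y'], so that the remainders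
   need not mention it. *)
Lemma qform_head (B : 'M[C]_n.+1) (e : R) : 0 < e -> exists2 r : R, 0 < r &
  forall z y, norm1 (z - xi) < r -> norm1 (z + y *m P - xi) < r ->
  normc (y 0 0) ^+ 2 <= 4 * normc (qform (P *m cgrad rho z) B y) ^+ 2 + e * tailsq y.
Proof.
move=> e0; have [c c0 cB] := normc_bilinear B.
pose e' := Num.min 1 e.
have e'0 : 0 < e' by rewrite lt_min ltr01.
have [e'1 e'e] : e' <= 1 /\ e' <= e by split; rewrite /e' ge_min lexx ?orbT.
(* Chosen so that |y_0|^2 <= 2 |L|^2 + (e'/2) (|y_0|^2 + |y'|^2); as e' <= 1, the term in |y_0|^2 on
   the right is absorbed on the left. *)
pose dl : R := e' / (4 * n.+1%:R).
have m0 : 1 <= (n.+1)%:R :> R by rewrite ler1n.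
have m0' : 0 < (n.+1)%:R :> R by rewrite ltr0n.
have dl0 : 0 < dl by rewrite divr_gt0// mulr_gt0.
have dlm : dl * n.+1%:R = e' / 4 by rewrite /dl; field; rewrite ?gt_eqF.
have [r1 r10 r1P] := near_small (divr_gt0 dl0 c0).
have [r2 r20 r2P] := grad_coord_near dl0.
exists (Num.min r1 r2) => [|z y]; first by rewrite lt_min r10.
rewrite !lt_min => /andP[z1 z2] /andP[y1 y2].
have ysm := r1P z y z1 y1.
have lin := normc_linear (fun j => r2P z j z2) y.
(* y_0 is L minus a linear and a quadratic perturbation, each at most [dl * norm1 y]: the first as
   [z] is near [xi], the second as [norm1 y <= dl / c]. *)
have y0E : y 0 0 = qform (P *m cgrad rho z) B y - (y *m (P *m cgrad rho z - delta_mx 0 0)) 0 0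
     - (y *m B *m y^T) 0 0.
  rewrite /qform mulmxBr; set a := y *m (P *m _); set b := _ *m y^T.
  have H : (y *m delta_mx 0 0 : 'M[C]_1) 0 0 = y 0 0 by rewrite -colE mxE.
  have E1 (M N : 'M[C]_1) : (M + N) 0 0 = M 0 0 + N 0 0 by rewrite mxE.
  have E2 (M : 'M[C]_1) : (- M) 0 0 = - M 0 0 by rewrite mxE.
  by rewrite !E1 E2 H; ring.
have bound : normc (y 0 0) <= normc (qform (P *m cgrad rho z) B y) + 2 * dl * norm1 y.
  rewrite {1}y0E; apply: le_trans (ler_normcB _ _) _.
  apply: (@le_trans _ _ (normc (qform (P *m cgrad rho z) B y) + dl * norm1 y +
    dl * norm1 y)); last lra.
  apply: lerD; first by apply: le_trans (ler_normcB _ _) _; rewrite lerD2l.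
  apply: le_trans (cB _ _) _; rewrite mulrA ler_wpM2r ?norm1_ge0//.
  by rewrite mulrC -ler_pdivlMr.
have sq := norm1_sq y.
set t := tailsq y in sq *; have t0 : 0 <= t by exact: tailsq_ge0.
set L := normc (qform (P *m cgrad rho z) B y) in bound *; have L0 : 0 <= L by exact: normc_ge0.
set u := normc (y 0 0) in bound sq *; have u0 : 0 <= u by exact: normc_ge0.
set N := norm1 y in bound sq *; have N0 : 0 <= N by exact: norm1_ge0.
have u2 : u ^+ 2 <= 2 * L ^+ 2 + 8 * dl ^+ 2 * N ^+ 2.
  apply: (@le_trans _ _ ((L + 2 * dl * N) ^+ 2)).
    have dN0 : 0 <= 2 * dl * N by rewrite mulr_ge0// mulr_ge0// ltW.
    by rewrite ler_pXn2r ?nnegrE ?addr_ge0.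
  rewrite -subr_ge0 (_ : _ - _ = (L - 2 * dl * N) ^+ 2) ?sqr_ge0//; ring.
have dN : 8 * dl ^+ 2 * N ^+ 2 <= e' / 2 * (u ^+ 2 + t).
  apply: (@le_trans _ _ (8 * dl ^+ 2 * (n.+1%:R * (u ^+ 2 + t)))).
    by rewrite ler_wpM2l// mulr_ge0// sqr_ge0.
  rewrite (_ : _ * _ = 8 * dl * (dl * n.+1%:R) * (u ^+ 2 + t)); last ring.
  rewrite ler_wpM2r ?addr_ge0 ?sqr_ge0// dlm.
  have : dl <= e' / 4.
    by rewrite -dlm ler_peMr// ltW.
  nra.
have e't : e' * t <= e * t by rewrite ler_wpM2r.
have uu : e' * u ^+ 2 <= u ^+ 2 by rewrite ler_piMl// sqr_ge0.
lra.
Qed.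

End Coordinates.

(** The term d |y_0|^2 from [levi_diag] has no definite sign; [qform_head] trades it for |L|^2 and a
    small multiple of |y'|^2. Thus [K] is fixed before [e]. *)
Lemma normal_form : exists (P B : 'M[C]_n.+1) (K : R),
  [/\ P \in unitmx, P *m cgrad rho xi = delta_mx 0 0, 0 <= K &
   forall e : R, 0 < e -> exists2 r : R, 0 < r &
   forall z y, norm1 (z - xi) < r -> norm1 (z + y *m P - xi) < r ->
   `|rho (z + y *m P) - rho z - 2 * complex.Re (qform (P *m cgrad rho z) B y) - tailsq y|
     <= K * normc (qform (P *m cgrad rho z) B y) ^+ 2 + e * tailsq y].
Proof.
have [P [d [Pu Pb Pd]]] := levi_diag.
pose B := P *m cquad rho xi *m P^T.
(* The 1 accounts for the part e' |y_0|^2 of the Taylor remainder, where e' <= 1. *)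
pose K := `|d| + 1; have K0 : 0 < K by rewrite ltr_wpDl.
exists P, B, (4 * K); split=> //; first by rewrite mulr_ge0// ltW.
move=> e e0.
have [c c0 cP] := norm1_mulmx P.
have m0' : 0 < (n.+1)%:R :> R by rewrite ltr0n.
pose e' := Num.min 1 (e / 2).
have e'0 : 0 < e' by rewrite lt_min ltr01 divr_gt0.
have [e'1 e'e] : e' <= 1 /\ e' <= e / 2 by split; rewrite /e' ge_min lexx ?orbT.
(* The denominator compensates the norm of [P] and the factor n + 1 of [norm1_sq]. *)
pose e1 := e' / (c ^+ 2 * n.+1%:R).
have e10 : 0 < e1 by rewrite divr_gt0// mulr_gt0// exprn_gt0.
have e20 : 0 < e / 2 / K by rewrite !divr_gt0.
have [r1 r10 r1P] := complex_taylor Uxi C2 e10.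
have [r2 r20 r2P] := qform_head Pu Pb B e20.
exists (Num.min r1 r2) => [|z y]; first by rewrite lt_min r10.
rewrite !lt_min => /andP[z1 z2] /andP[y1 y2].
have := r2P z y z2 y2.
have := r1P z (y *m P) z1 y1; rewrite Pd.
have -> : (y *m P *m cgrad rho z + y *m P *m cquad rho xi *m (y *m P)^T) 0 0 =
    qform (P *m cgrad rho z) B y.
  by rewrite /qform /B trmx_mul !mulmxA.
move: (rho (_ + _)) (rho z) (qform _ _ _) => a b L.
set u := normc (y 0 0); set t := tailsq y.
have t0 : 0 <= t by exact: tailsq_ge0.
move=> H1 H2.
have H3 : e1 * norm1 (y *m P) ^+ 2 <= e' * (u ^+ 2 + t).
  apply: (@le_trans _ _ (e1 * (c ^+ 2 * (n.+1%:R * (u ^+ 2 + t))))).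
    rewrite ler_wpM2l ?(ltW e10)//; apply: (@le_trans _ _ ((c * norm1 y) ^+ 2)).
      have cN0 : 0 <= c * norm1 y by rewrite mulr_ge0 ?norm1_ge0// ltW.
      by rewrite ler_pXn2r ?nnegrE ?norm1_ge0.
    by rewrite exprMn ler_wpM2l ?sqr_ge0// norm1_sq.
  rewrite le_eqVlt; apply/orP; left; apply/eqP; rewrite /e1; field.
  by rewrite !gt_eqF.
have H4 : `|a - b - 2 * complex.Re L - t| <= `|d| * u ^+ 2 + e' * (u ^+ 2 + t).
  have -> : a - b - 2 * complex.Re L - t =
     d * u ^+ 2 + (a - b - 2 * complex.Re L - (d * u ^+ 2 + t)) by ring.
  apply: le_trans (ler_normD _ _) _; apply: lerD.
    by rewrite normrM [`|u ^+ 2|]ger0_norm ?sqr_ge0.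
  exact: le_trans H1 H3.
have u0 : 0 <= u ^+ 2 by exact: sqr_ge0.
have H5 : K * u ^+ 2 <= 4 * K * normc L ^+ 2 + e / 2 * t.
  apply: (@le_trans _ _ (K * (4 * normc L ^+ 2 + e / 2 / K * t))).
    by rewrite ler_wpM2l// ltW.
  by rewrite le_eqVlt; apply/orP; left; apply/eqP; field; rewrite gt_eqF.
have H6 : e' * u ^+ 2 <= u ^+ 2 by rewrite ler_piMl.
have H7 : e' * t <= e / 2 * t by rewrite ler_wpM2r.
rewrite /K in H5 *; lra.
Qed.

End StronglyPseudoconvex.

(** * Complex differentiability of rational maps *)

Section RationalMap.
Variables (K : numFieldType) (m : nat).
Local Notation V := 'rV[K]_m.+1.
Implicit Types (f g : V -> K) (w : V).

Lemma differentiable_bigsum (W : normedModType K) (I : Type) (s : seq I)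
    (F : I -> V -> W) w : (forall j, differentiable (F j) w) ->
  differentiable (fun x => \sum_(j <- s) F j x) w.
Proof.
move=> dF; elim: s => [|j s IH].
  by rewrite (_ : (fun _ => _) = cst 0)//; apply/funext => x; rewrite big_nil.
rewrite (_ : (fun _ => _) = F j + (fun x => \sum_(j <- s) F j x)).
  exact: differentiableD.
by apply/funext => x; rewrite big_cons.
Qed.

Lemma differentiable_mul f g w : differentiable f w -> differentiable g w ->
  differentiable (fun x => f x * g x) w.
Proof. by move=> df dg; exact: (@differentiableM _ _ f g). Qed.

Lemma differentiable_add f g w : differentiable f w -> differentiable g w ->
  differentiable (fun x => f x + g x) w.
Proof. by move=> df dg; exact: (@differentiableD _ _ _ f g). Qed.

Lemma differentiable_cmul (a : K) f w : differentiable f w ->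
  differentiable (fun x => a * f x) w.
Proof. by move=> df; apply: differentiable_mul => //; exact: differentiable_cst. Qed.

Lemma differentiable_inv_sub (a : K) f w : differentiable f w -> a - f w != 0 ->
  differentiable (fun x => (a - f x)^-1) w.
Proof.
move=> df n0; apply: (@differentiableV _ _ (fun x => a - f x)) => //.
apply: (@differentiable_add (cst a) (fun x => - f x)).
  exact: differentiable_cst.
exact: differentiableN.
Qed.

Lemma differentiable_affine (z : V) (Q : 'M[K]_m.+1) j w :
  differentiable (fun x => ((x - z) *m Q) 0 j) w.
Proof.
rewrite (_ : (fun _ => _) = fun x : V => \sum_k (x 0 k - z 0 k) * Q k j); last first.
  by apply/funext => x; rewrite mxE; apply: eq_bigr => k _; rewrite !mxE.
apply: differentiable_bigsum => k; apply: differentiable_mul => //.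
apply: (@differentiable_add (fun x => x 0 k) (cst (- z 0 k))) => //.
exact: differentiable_coord.
Qed.

Lemma differentiable_quad (y : V -> V) (g : 'cV[K]_m.+1) (B : 'M[K]_m.+1) w :
  (forall j, differentiable (fun x => y x 0 j) w) ->
  differentiable (fun x => (y x *m g + y x *m B *m (y x)^T) 0 0) w.
Proof.
move=> dy.
rewrite (_ : (fun _ => _) = fun x : V => \sum_j y x 0 j * g j 0 +
    \sum_k (\sum_j y x 0 j * B j k) * y x 0 k); last first.
  apply/funext => x; rewrite !mxE; congr (_ + _); apply: eq_bigr => k _.
  by rewrite !mxE.
apply: differentiable_add; apply: differentiable_bigsum => j.
  exact: differentiable_mul.
apply: differentiable_mul => //; apply: differentiable_bigsum => k.
exact: differentiable_mul.
Qed.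

Lemma differentiable_row (F : V -> V) w :
  (forall j, differentiable (fun x => F x 0 j) w) -> differentiable F w.
Proof.
move=> dF; rewrite (_ : F = fun x : V => \sum_j F x 0 j *: delta_mx 0 j).
  by apply: differentiable_bigsum => j; exact: differentiableZl.
by apply/funext => x; exact: row_sum_delta.
Qed.

End RationalMap.

(** * The projective map between the model domain and the ball *)

Section Blowup.
Variables (R : realType) (n : nat).
Local Notation C := R[i].
Local Notation CV := 'rV[C]_n.+1.
Implicit Types (L : C) (y w : CV).

Lemma enorm_lt w (r : R) : 0 < r ->
  (enorm w < r) = (normc (w 0 0) ^+ 2 + tailsq w < r ^+ 2).
Proof.
move=> r0; rewrite /enorm big_ord_recl -/(tailsq w).
by rewrite -[RHS](@ltr_sqrt _ _ (r ^+ 2)) ?exprn_gt0// sqrtr_sqr ger0_norm// ltW.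
Qed.

Lemma normc_realB (t : R) L :
  normc (t%:C - L) ^+ 2 = t ^+ 2 - 2 * t * complex.Re L + normc L ^+ 2.
Proof. by rewrite !sqr_normc_ReIm; case: L => a b /=; ring. Qed.

Lemma normc_gt0 (x : C) : (0 < normc x) = (x != 0).
Proof.
rewrite lt_def normc_ge0 andbT; congr negb.
apply/eqP/eqP => [|->]; last exact: Normc.normc0.
exact: Normc.eq0_normc.
Qed.

Variables tau mu : R.
Hypotheses (tau0 : 0 < tau) (mu0 : 0 < mu).

(* In the coordinates (L, y'), this maps the model domain
   {2 Re L + |y'|^2 < tau} into the ball of radius mu, sending the origin to
   the origin. *)
Definition blowup L y : CV := (mu%:C / (tau%:C - L)) *:
  \row_j (if j == 0 then L else (Num.sqrt tau)%:C * y 0 j).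

Lemma blowup_head L y : blowup L y 0 0 = mu%:C / (tau%:C - L) * L.
Proof. by rewrite !mxE eqxx. Qed.

Lemma blowup_tail L y j : blowup L y 0 (lift 0 j) =
  mu%:C / (tau%:C - L) * ((Num.sqrt tau)%:C * y 0 (lift 0 j)).
Proof. by rewrite !mxE. Qed.

Lemma blowup_norm L y : normc (blowup L y 0 0) ^+ 2 + tailsq (blowup L y) =
  mu ^+ 2 / normc (tau%:C - L) ^+ 2 * (normc L ^+ 2 + tau * tailsq y).
Proof.
have k2 : normc (mu%:C / (tau%:C - L)) ^+ 2 = mu ^+ 2 / normc (tau%:C - L) ^+ 2.
  rewrite Normc.normcM Normc.normcV normc_real exprMn exprVn.
  by rewrite real_normK ?num_real.
rewrite blowup_head Normc.normcM exprMn k2 mulrDr; congr (_ + _).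
rewrite /tailsq !mulr_sumr; apply: eq_bigr => j _.
rewrite blowup_tail Normc.normcM exprMn k2 Normc.normcM exprMn normc_real.
by rewrite real_normK ?num_real// sqr_sqrtr// ltW.
Qed.

(** Multiplied by [tau], the hypothesis becomes mu^2 (|L|^2 + tau |y'|^2) < |tau - L|^2, because
    |tau - L|^2 = tau^2 - 2 tau Re L + |L|^2. Strictness excludes the pole. *)
Lemma blowup_ball L y :
  - tau + 2 * complex.Re L + mu ^+ 2 * tailsq y < (1 - mu ^+ 2) / tau * normc L ^+ 2 ->
  tau%:C - L != 0 /\ enorm (blowup L y) < 1.
Proof.
move=> H.
have lt : mu ^+ 2 * (normc L ^+ 2 + tau * tailsq y) < normc (tau%:C - L) ^+ 2.
  rewrite normc_realB.
  have : tau * (- tau + 2 * complex.Re L + mu ^+ 2 * tailsq y) <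
      tau * ((1 - mu ^+ 2) / tau * normc L ^+ 2) by rewrite ltr_pM2l.
  rewrite (_ : tau * (_ / tau * _) = (1 - mu ^+ 2) * normc L ^+ 2); first lra.
  by field; rewrite gt_eqF.
have X0 : 0 < normc (tau%:C - L) ^+ 2.
  apply: le_lt_trans lt; rewrite mulr_ge0 ?sqr_ge0// addr_ge0 ?sqr_ge0//.
  by rewrite mulr_ge0 ?tailsq_ge0// ltW.
split.
  apply/eqP => E; move: X0; rewrite E Normc.normc0 expr0n/=.
  by rewrite ltxx.
rewrite enorm_lt// blowup_norm expr1n mulrAC -mulrA mulrC.
by rewrite mulrC mulrA ltr_pdivrMr// mul1r.
Qed.

(** L / (tau - L) is an injective Moebius map. The entry y_0 does not enter [blowup]; it is
    recovered from L by [qform_inj]. *)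
Lemma blowup_inj L1 L2 y1 y2 : tau%:C - L1 != 0 -> tau%:C - L2 != 0 ->
  blowup L1 y1 = blowup L2 y2 ->
  L1 = L2 /\ forall j, y1 0 (lift 0 j) = y2 0 (lift 0 j).
Proof.
move=> L10 L20 E.
have tC : tau%:C != 0 :> C by rewrite fmorph_eq0 gt_eqF.
have mC : mu%:C != 0 :> C by rewrite fmorph_eq0 gt_eqF.
have LE : L1 = L2.
  have := congr1 (fun M : CV => M 0 0) E; rewrite !blowup_head => H.
  have : L1 * (tau%:C - L2) = L2 * (tau%:C - L1).
    apply: (mulfI mC); apply: (mulIf (invr_neq0 L10)); apply: (mulIf (invr_neq0 L20)).
    transitivity (mu%:C / (tau%:C - L1) * L1); first by field; rewrite L10 L20.
    by rewrite H; field; rewrite L10 L20.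
  move/eqP; rewrite -subr_eq0 (_ : _ - _ = tau%:C * (L1 - L2)); last by ring.
  by rewrite mulf_eq0 (negPf tC)/= subr_eq0 => /eqP.
split=> // j; have := congr1 (fun M : CV => M 0 (lift 0 j)) E.
rewrite !blowup_tail LE; apply: contra_eq => yn.
have kn : mu%:C / (tau%:C - L2) != 0 by rewrite mulf_neq0// invr_neq0.
have sn : (Num.sqrt tau)%:C != 0 :> C by rewrite fmorph_eq0 gt_eqF// sqrtr_gt0.
by apply: contra yn => /eqP/(mulfI kn)/(mulfI sn) ->.
Qed.

(** Solving a = L / (tau - L) gives L = tau a / (1 + a), and |a| < 1 - e keeps |1 + a| >= e, whence
    the bounds in tau / e. Only the tail of [c] is determined here; [qform_solve] supplies the first
    entry. *)
Lemma blowup_surj (e : R) w : 0 < e -> e < 1 ->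
  normc (w 0 0) ^+ 2 + tailsq w < ((1 - e) * mu) ^+ 2 ->
  exists L (c : CV), [/\ c 0 0 = 0, normc L <= tau / e, tailsq c <= tau / e ^+ 2,
    normc L ^+ 2 + tau * tailsq c < (1 - e) ^+ 2 * normc (tau%:C - L) ^+ 2 &
    forall y, (forall j, y 0 (lift 0 j) = c 0 (lift 0 j)) -> blowup L y = w].
Proof.
move=> e0 e1 wlt.
have mC : mu%:C != 0 :> C by rewrite fmorph_eq0 gt_eqF.
have tC : tau%:C != 0 :> C by rewrite fmorph_eq0 gt_eqF.
have s0 : 0 < Num.sqrt tau by rewrite sqrtr_gt0.
have sC : (Num.sqrt tau)%:C != 0 :> C by rewrite fmorph_eq0 gt_eqF.
have ss : (Num.sqrt tau)%:C * (Num.sqrt tau)%:C = tau%:C :> C.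
  by rewrite -rmorphM -expr2 sqr_sqrtr// ltW.
have [a aE] : exists a : C, a = w 0 0 / mu%:C by exists (w 0 0 / mu%:C).
pose T : R := tailsq w / mu ^+ 2.
have aT : normc a ^+ 2 + T < (1 - e) ^+ 2.
  rewrite aE /T Normc.normcM Normc.normcV normc_real exprMn exprVn real_normK ?num_real//.
  by rewrite -mulrDl ltr_pdivrMr ?exprn_gt0// -exprMn.
have T0 : 0 <= T by rewrite divr_ge0 ?tailsq_ge0 ?sqr_ge0.
have e1' : 0 <= 1 - e by rewrite subr_ge0 ltW.
have a1 : normc a < 1 - e.
  by rewrite -(@ltr_pXn2r _ 2) ?nnegrE ?normc_ge0//; lra.
have ea : e <= normc (1 + a).
  have := ler_normcB (1 + a) a; rewrite addrK Normc.normc1; lra.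
have na0 : 0 < normc (1 + a) by exact: lt_le_trans ea.
have a0 : 1 + a != 0 by rewrite -normc_gt0.
pose L := tau%:C * a / (1 + a).
pose k := (Num.sqrt tau)%:C / (mu%:C * (1 + a)).
pose c : CV := k *: \row_j (if j == 0 then 0 else w 0 j).
have tL : tau%:C - L = tau%:C / (1 + a) by rewrite /L; field.
have k2 : normc k ^+ 2 = tau / (mu ^+ 2 * normc (1 + a) ^+ 2).
  rewrite /k Normc.normcM Normc.normcV Normc.normcM !normc_real exprMn exprVn exprMn.
  by rewrite !real_normK ?num_real// sqr_sqrtr// ltW.
have tc : tailsq c = tau * T / normc (1 + a) ^+ 2.
  rewrite (_ : tailsq c = normc k ^+ 2 * tailsq w).
    by rewrite k2 /T; field; rewrite !gt_eqF.
  rewrite /tailsq mulr_sumr; apply: eq_bigr => j _.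
  by rewrite !mxE Normc.normcM exprMn.
have nL : normc L = tau * normc a / normc (1 + a).
  by rewrite /L !Normc.normcM Normc.normcV normc_real ger0_norm ?(ltW tau0)//.
have ntL : normc (tau%:C - L) = tau / normc (1 + a).
  by rewrite tL Normc.normcM Normc.normcV normc_real ger0_norm ?(ltW tau0)//.
have T1 : T <= 1.
  have := sqr_ge0 (normc a); have : (1 - e) ^+ 2 <= 1 by rewrite expr_le1//; lra.
  lra.
exists L, c; split.
- by rewrite !mxE eqxx mulr0.
- rewrite nL -mulrA ler_wpM2l ?(ltW tau0)//.
  rewrite ler_pdivrMr// mulrC ler_pdivlMr//.
  by have := normc_ge0 a; nra.
- rewrite tc -mulrA ler_wpM2l ?(ltW tau0)// ler_pdivrMr ?exprn_gt0// mulrC.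
  rewrite ler_pdivlMr ?exprn_gt0//.
  have : e ^+ 2 <= normc (1 + a) ^+ 2 by rewrite ler_pXn2r ?nnegrE ?(ltW e0) ?(ltW na0).
  have := sqr_ge0 e; nra.
- rewrite nL tc ntL.
  rewrite (_ : _ + _ = (tau / normc (1 + a)) ^+ 2 * (normc a ^+ 2 + T)).
    by rewrite mulrC ltr_pM2r// exprn_gt0// divr_gt0.
  by field; rewrite gt_eqF.
move=> y yc; apply/rowP => j; case: (unliftP 0 j) => [j'|] ->.
  rewrite blowup_tail yc tL !mxE /k.
  transitivity (((Num.sqrt tau)%:C * (Num.sqrt tau)%:C) / tau%:C * w 0 (lift 0 j')).
    by rewrite /=; field; rewrite mC tC a0.
  by rewrite ss divff// mul1r.
have wa : w 0 0 = a * mu%:C by rewrite aE divfK.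
by rewrite blowup_head tL /L wa; field; rewrite a0 tC.
Qed.

(** The sign of the square root d of the discriminant is chosen so that |b + d| >= |b|. Written as
    -2k / (b + d), the root also makes sense for q = 0 and is visibly small. *)
Lemma small_quadratic_root (q b k : C) : 2^-1 <= normc b ->
  exists2 s, q * s ^+ 2 + b * s + k = 0 & normc s <= 4 * normc k.
Proof.
move=> b2; pose D := sqrtc (b ^+ 2 - 4 * q * k).
have D2 : D ^+ 2 = b ^+ 2 - 4 * q * k by rewrite sqr_sqrtc.
have [d d2 bd] : exists2 d : C, d ^+ 2 = D ^+ 2 & normc b <= normc (b + d).
  have : normc b <= normc (b + D) \/ normc b <= normc (b - D).
    have : normc (b + D + (b - D)) = 2 * normc b.
      rewrite (_ : _ + _ = 2%:C * b); first by rewrite Normc.normcM normc_real ger0_norm.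
      by rewrite rmorph_nat; ring.
    have := le_normcD (b + D) (b - D).
    by have [?|?] := leP (normc b) (normc (b + D)); [left|right; lra].
  by case=> H; [exists D|exists (- D); rewrite ?sqrrN].
have bd0 : b + d != 0 by rewrite -normc_gt0; apply: lt_le_trans bd; lra.
exists (- 2 * k / (b + d)).
  have : d ^+ 2 = b ^+ 2 - 4 * q * k by rewrite d2 D2.
  move=> E; have : 4 * q * k = b ^+ 2 - d ^+ 2 by rewrite E; ring.
  move=> E2.
  have -> : q * (- 2 * k / (b + d)) ^+ 2 + b * (- 2 * k / (b + d)) + k =
     k * (4 * q * k - 2 * b * (b + d) + (b + d) ^+ 2) / (b + d) ^+ 2 by field.
  by rewrite E2 (_ : _ + (b + d) ^+ 2 = 0) ?mulr0 ?mul0r//; ring.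
rewrite !Normc.normcM Normc.normcV normcN.
have -> : normc (2 : C) = 2 by rewrite -(rmorph_nat (real_complex R)) normc_real ger0_norm.
rewrite ler_pdivrMr; last by apply: lt_le_trans bd; lra.
have := normc_ge0 k; nra.
Qed.

End Blowup.

(** * Injectivity and solvability of the quadratic coordinate *)

Section QuadraticCoordinate.
Variables (R : realType) (n : nat).
Local Notation C := R[i].
Local Notation CV := 'rV[C]_n.+1.
Local Notation e0 := (delta_mx 0 0 : 'rV[R[i]]_n.+1).

Variables (g : 'cV[C]_n.+1) (B : 'M[C]_n.+1).

Local Notation qform := (qform g B).

Lemma qform_line (y : CV) (s : C) : qform (y + s *: e0) =
  (e0 *m B *m e0^T) 0 0 * s ^+ 2 +
  ((e0 *m g) 0 0 + (y *m B *m e0^T) 0 0 + (e0 *m B *m y^T) 0 0) * s + qform y.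
Proof.
rewrite /qform linearD/= linearZ/= !mulmxDl !mulmxDr.
rewrite -!scalemxAl -?scalemxAr.
have E1 (M N : 'M[C]_1) : (M + N) 0 0 = M 0 0 + N 0 0 by rewrite mxE.
have E2 (a : C) (M : 'M[C]_1) : (a *: M) 0 0 = a * M 0 0 by rewrite mxE.
by rewrite !E1 !E2; ring.
Qed.

Variable c : R.
Hypothesis g_near : forall j, normc ((g - delta_mx 0 0) j 0) <= 4^-1.
Hypothesis c0 : 0 < c.
Hypothesis cB : forall x y : CV, normc ((x *m B *m y^T) 0 0) <= c * (norm1 x * norm1 y).

Lemma norm1_delta : norm1 e0 = 1.
Proof.
rewrite /norm1 big_ord_recl big1 => [|j _]; last by rewrite mxE Normc.normc0.
by rewrite mxE addr0 Normc.normc1.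
Qed.

(** For nonzero [s] this is the difference quotient of [qform] from [y] in the direction e_0. It is
    1 up to an error 1/4 from [g] and 1/4 from [B]. It is applied with s = x_0 - y_0 for injectivity
    and with s = 0 for solvability. *)
Lemma head_coef (y : CV) (s : C) : c * (2 * norm1 y + normc s) <= 4^-1 ->
  2^-1 <= normc ((e0 *m B *m e0^T) 0 0 * s +
    ((e0 *m g) 0 0 + (y *m B *m e0^T) 0 0 + (e0 *m B *m y^T) 0 0)).
Proof.
move=> small.
set q := (_ *m e0^T) 0 0; set a := (_ *m e0^T) 0 0; set b := (_ *m y^T) 0 0.
have q1 : normc (q * s) <= c * normc s.
  rewrite Normc.normcM ler_wpM2r ?normc_ge0//.
  by have := cB e0 e0; rewrite norm1_delta !mulr1.
have a1 : normc a <= c * norm1 y by have := cB y e0; rewrite norm1_delta mulr1.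
have b1 : normc b <= c * norm1 y by have := cB e0 y; rewrite norm1_delta mul1r.
have g1 : normc ((e0 *m g) 0 0 - 1) <= 4^-1.
  have := g_near 0; rewrite -rowE !mxE; exact.
have -> : q * s + ((e0 *m g) 0 0 + a + b) =
    1 - ((1 - (e0 *m g) 0 0) - (q * s + (a + b))) by ring.
have : normc (1 : C) <= normc (1 - ((1 - (e0 *m g) 0 0) - (q * s + (a + b)))) +
   normc ((1 - (e0 *m g) 0 0) - (q * s + (a + b))).
  by apply: le_trans (le_normcD _ _); rewrite subrK.
have := ler_normcB (1 - (e0 *m g) 0 0) (q * s + (a + b)).
have := le_normcD (q * s) (a + b).
have := le_normcD a b.
have : normc (1 - (e0 *m g) 0 0) <= 4^-1 by rewrite -normcN opprB.
rewrite Normc.normc1; lra.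
Qed.

Lemma qform_inj (x y : CV) : c * norm1 x <= 16^-1 -> c * norm1 y <= 16^-1 ->
  qform x = qform y -> (forall j, x 0 (lift 0 j) = y 0 (lift 0 j)) -> x = y.
Proof.
move=> xs ys qxy tl; pose s := x 0 0 - y 0 0.
have xE : x = y + s *: e0.
  apply/rowP => j; rewrite !mxE/=; case: (unliftP 0 j) => [j'|] ->.
    by rewrite tl mulr0 addr0.
  by rewrite mulr1 /s addrC subrK.
have ss : normc s <= norm1 x + norm1 y.
  by apply: le_trans (ler_normcB _ _) _; rewrite lerD ?norm1_coord.
(* 2 |y| + |s| <= |x| + 3 |y|: four terms of size 1/16 after multiplication by [c]. *)
have /head_coef H : c * (2 * norm1 y + normc s) <= 4^-1.
  have : c * normc s <= c * (norm1 x + norm1 y) by rewrite ler_wpM2l// ltW.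
  lra.
have : s * ((e0 *m B *m e0^T) 0 0 * s +
    ((e0 *m g) 0 0 + (y *m B *m e0^T) 0 0 + (e0 *m B *m y^T) 0 0)) = 0.
  move: qxy; rewrite {1}xE qform_line => /eqP; rewrite -subr_eq0 => /eqP <-; ring.
move/eqP; rewrite mulf_eq0 => /orP[/eqP s0|/eqP E].
  by rewrite xE s0 scale0r addr0.
by move: H; rewrite E Normc.normc0 leNgt invr_gt0 ltr0n.
Qed.

Lemma qform_le (y : CV) : c * norm1 y <= 8^-1 -> normc (qform y) <= 2 * norm1 y.
Proof.
move=> ys; apply: (@le_trans _ _ (5 / 4 * norm1 y + 8^-1 * norm1 y)); last first.
  by have := norm1_ge0 y; lra.
rewrite /qform mxE; apply: le_trans (le_normcD _ _) _; apply: lerD.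
  apply: normc_linear => j.
  have -> : g j 0 = (g - delta_mx 0 0) j 0 + (delta_mx 0 0 : 'cV[C]_n.+1) j 0.
    by rewrite !mxE subrK.
  apply: le_trans (le_normcD _ _) _.
  apply: (@le_trans _ _ (4^-1 + 1)); last lra.
  apply: lerD => //; rewrite mxE; case: (_ && _); first by rewrite Normc.normc1.
  by rewrite Normc.normc0.
apply: le_trans (cB _ _) _; rewrite mulrA ler_wpM2r ?norm1_ge0//.
Qed.

Lemma qform_solve (y : CV) (L : C) : c * norm1 y <= 8^-1 ->
  exists2 x : CV, qform x = L /\ forall j, x 0 (lift 0 j) = y 0 (lift 0 j) &
    norm1 x <= 4 * normc L + 9 * norm1 y.
Proof.
move=> ys.
have /head_coef : c * (2 * norm1 y + normc (0 : C)) <= 4^-1.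
  by rewrite Normc.normc0 addr0; lra.
rewrite mulr0 add0r => b2.
have [s sE sk] := @small_quadratic_root R ((e0 *m B *m e0^T) 0 0) _ (qform y - L) b2.
exists (y + s *: e0); first split.
- rewrite qform_line -[RHS]add0r -sE; ring.
- by move=> j; rewrite !mxE/= mulr0 addr0.
(* The root satisfies |s| <= 4 |qform y - L| and |qform y| <= 2 |y|, which explains 9 = 1 + 4 *
   2. *)
apply: le_trans (norm1D _ _) _; rewrite norm1Z norm1_delta mulr1.
have qy := qform_le ys.
have := ler_normcB (qform y) L; have := norm1_ge0 y; have := normc_ge0 L.
lra.
Qed.

End QuadraticCoordinate.

(** * Bounds for the squeezing function *)

Section Squeezing.
Variables (R : realType) (n : nat).
Local Notation C := R[i].
Local Notation CV := 'rV[C]_n.+1.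

Lemma enorm_head (s : R) : 0 <= s -> enorm (s%:C *: delta_mx 0 0 : CV) = s.
Proof.
move=> s0; rewrite /enorm big_ord_recl big1 => [|j _].
  by rewrite addr0 !mxE mulr1 normc_real real_normK ?num_real// sqrtr_sqr ger0_norm.
by rewrite !mxE mulr0 Normc.normc0 expr0n.
Qed.

Lemma squeezing_radius_le1 (D : set CV) p f (r : R) :
  ball_embedding D p f -> eball 0 r `<=` f @` D -> r <= 1.
Proof.
move=> [_ _ fD _] rf; rewrite leNgt; apply/negP => r1.
(* If r > 1, a point of norm strictly between 1 and [r] contradicts the inclusion in the unit
   ball. *)
have s0 : 0 <= (1 + r) / 2 by lra.
have /rf/fD : eball 0 r (((1 + r) / 2)%:C *: delta_mx 0 0 : CV).
  by rewrite /eball/= subr0 enorm_head//; lra.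
by rewrite /eball/= subr0 enorm_head//; lra.
Qed.

Lemma squeezing_at_le1 (D : set CV) p f : ball_embedding D p f -> squeezing_at D f <= 1.
Proof.
move=> fe; rewrite /squeezing_at; set S := [set r | _].
have [[r Sr]|S0] := pselect (S !=set0).
  by apply: ge_sup; [exists r|move=> s [_ sf]; exact: squeezing_radius_le1 fe sf].
(* With no admissible radius the supremum is 0 by convention, still at most 1. *)
by rewrite (_ : S = set0) ?sup0// -subset0 => r Sr; apply: S0; exists r.
Qed.

Lemma squeezing_le1 (D : set CV) p : squeezing D p <= 1.
Proof.
rewrite /squeezing; set S := [set _ | f in _].
have [[r Sr]|S0] := pselect (S !=set0).
  by apply: ge_sup; [exists r|move=> _ [f fe <-]; exact: squeezing_at_le1 fe].
by rewrite (_ : S = set0) ?sup0// -subset0 => r Sr; apply: S0; exists r.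
Qed.

Lemma squeezing_ge (D : set CV) p f (r : R) : ball_embedding D p f -> 0 < r ->
  eball 0 r `<=` f @` D -> r <= squeezing D p.
Proof.
move=> fe r0 rf; apply: (@le_trans _ _ (squeezing_at D f)).
  apply: ub_le_sup; last by split.
  by exists 1 => s [_ sf]; exact: squeezing_radius_le1 fe sf.
apply: ub_le_sup; last by exists f.
by exists 1 => _ [h he <-]; exact: squeezing_at_le1 he.
Qed.

(** The analysis is reduced to two conditions on L: the one on points of [D] places the image in the
    ball and makes the map injective, the other produces preimages in [D] for the ball of radius (1
    - e)^2. The length [eta] bounds both |y'| and |L| of these preimages. *)
Lemma squeezing_lower (D : set CV) (z : CV) (P B : 'M[C]_n.+1) (g : 'cV[C]_n.+1)
    (c tau e eta : R) :
  P \in unitmx -> (forall j, normc ((g - delta_mx 0 0) j 0) <= 4^-1) -> 0 < c ->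
  (forall x y : CV, normc ((x *m B *m y^T) 0 0) <= c * (norm1 x * norm1 y)) ->
  0 < tau -> 0 < e -> e < 1 ->
  0 < eta -> c * eta <= 8^-1 -> tau / e <= eta -> n.+1%:R * (tau / e ^+ 2) <= eta ^+ 2 ->
  (forall w, D w -> let y := (w - z) *m invmx P in c * norm1 y <= 16^-1 /\
    - tau + 2 * complex.Re (qform g B y) + (1 - e) ^+ 2 * tailsq y <
      (1 - (1 - e) ^+ 2) / tau * normc (qform g B y) ^+ 2) ->
  (forall y, norm1 y <= 13 * eta -> normc (qform g B y) <= tau / e ->
    normc (qform g B y) ^+ 2 + tau * tailsq y <
      (1 - e) ^+ 2 * normc (tau%:C - qform g B y) ^+ 2 -> D (z + y *m P)) ->
  D z -> (1 - e) * (1 - e) <= squeezing D z.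
Proof.
move=> Pu gn c0 cB tau0 e0 e1 eta0 ceta te nte Din Dout Dz.
have mu0 : 0 < 1 - e by rewrite subr_gt0.
pose Y (w : CV) : CV := (w - z) *m invmx P.
pose f (w : CV) : CV := blowup tau (1 - e) (qform g B (Y w)) (Y w).
have fball w : D w -> tau%:C - qform g B (Y w) != 0 /\ enorm (f w) < 1.
  by move=> /Din[_ H]; exact: blowup_ball.
apply: (@squeezing_ge _ _ f); last 2 first.
- by rewrite mulr_gt0.
- move=> w; rewrite /eball/= subr0 enorm_lt ?mulr_gt0// => wlt.
  have [L [y [y0 Lt yt sq fy]]] := blowup_surj tau0 mu0 e0 e1 wlt.
  have ysm : norm1 y <= eta.
    rewrite -(@ler_pXn2r _ 2) ?nnegrE ?norm1_ge0 ?(ltW eta0)//.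
    apply: le_trans (norm1_sq _) _; apply: le_trans nte.
    by rewrite y0 Normc.normc0 expr0n add0r ler_wpM2l ?ler0n.
  have cy : c * norm1 y <= 8^-1 by apply: le_trans ceta; rewrite ler_wpM2l// ltW.
  have [x [xL xt] xs] := qform_solve gn cB L cy.
  have tE : tailsq x = tailsq y by apply: eq_bigr => j _; rewrite xt.
  (* |x| <= 4 |L| + 9 |y| <= 13 eta, since |L| <= tau / e <= eta. *)
  exists (z + x *m P).
    apply: Dout; rewrite ?xL ?tE//; lra.
  have YE : Y (z + x *m P) = x by rewrite /Y addrC addKr mulmxK.
  by rewrite /f YE xL; apply: fy.
have dY j w : differentiable (fun x => Y x 0 j) w by exact: differentiable_affine.
have dL w : differentiable (fun x => qform g B (Y x)) w by exact: differentiable_quad.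
split.
- move=> w Dw; apply: differentiable_row => j.
  have [L0 _] := fball _ Dw.
  have -> : (fun x => f x 0 j) = (fun x => (1 - e)%:C * (tau%:C - qform g B (Y x))^-1 *
     (if j == 0 then qform g B (Y x) else (Num.sqrt tau)%:C * Y x 0 j)).
    by apply/funext => x; rewrite /f /blowup !mxE.
  have dI := differentiable_inv_sub (dL w) L0.
  have [_|_] := eqVneq j 0.
    exact: differentiable_mul (differentiable_cmul _ dI) (dL w).
  exact: differentiable_mul (differentiable_cmul _ dI) (differentiable_cmul _ (dY j w)).
- move=> w w' /set_mem Dw /set_mem Dw' ff.
  have [L0 _] := fball _ Dw; have [L0' _] := fball _ Dw'.
  have [LE tE] := blowup_inj tau0 mu0 L0 L0' ff.
  have [cw _] := Din _ Dw; have [cw' _] := Din _ Dw'.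
  have YE : Y w = Y w' by apply: (qform_inj gn c0 cB).
  apply: (addIr (- z)).
  by rewrite -(mulmxKV Pu (w - z)) -(mulmxKV Pu (w' - z)) -/(Y w) YE.
- by move=> _ [w Dw <-]; rewrite /eball/= subr0; have [] := fball _ Dw.
have Y0 : Y z = 0 by rewrite /Y subrr mul0mx.
rewrite /f Y0 (_ : qform g B 0 = 0); last by rewrite /qform !mul0mx addr0 mxE.
by apply/rowP => j; rewrite !mxE; case: ifP; rewrite !mulr0.
Qed.

End Squeezing.

(** * Scalar inequalities behind the two inclusions *)

Lemma outer_near (R : realType) (tau K e rl l tl : R) :
  0 < tau -> 0 <= K -> 0 < e -> e < 1 -> 0 <= l -> 0 <= tl ->
  tau * K <= 1 - (1 - e) ^+ 2 ->
  - tau + 2 * rl + tl - (K * l ^+ 2 + e * tl) < 0 ->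
  - tau + 2 * rl + (1 - e) ^+ 2 * tl < (1 - (1 - e) ^+ 2) / tau * l ^+ 2.
Proof.
move=> tau0 K0 e0 e1 l0 tl0 tK H.
(* The smallness of [tau] pays for the error K l^2, and (1 - e)^2 <= 1 - e pays for e tl. *)
have : K * l ^+ 2 <= (1 - (1 - e) ^+ 2) / tau * l ^+ 2.
  by rewrite ler_wpM2r ?sqr_ge0// ler_pdivlMr// mulrC.
have : (1 - e) ^+ 2 * tl <= (1 - e) * tl.
  have [? ?] : 0 <= 1 - e /\ 1 - e <= 1 by split; rewrite ?subr_ge0 ?gerBl ltW.
  by rewrite ler_wpM2r// expr2 ler_piMl.
lra.
Qed.

(** The negativity of rho, known through Taylor's formula with constant 1/2, bounds tl / 2 by tau +
    (2 + K) l. Since s <= 4 l^2 + 2 tl and tau <= s / 8, this forces l >= s / (24 + 8 K). The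
    right-hand side then exceeds K l^2 + 1, and the 1 covers the missing tl / 2. *)
Lemma outer_far (R : realType) (tau K e rl l tl : R) (s : R) :
  0 < tau -> 0 <= K -> 0 < e -> e < 1 -> 0 <= l -> 0 <= tl ->
  0 < s -> - l <= rl -> l <= 1 -> tl <= 1 ->
  s <= 4 * l ^+ 2 + 2 * tl -> tau <= s / 8 ->
  tau * ((24 + 8 * K) ^+ 2 / s ^+ 2 + K) <= 1 - (1 - e) ^+ 2 ->
  - tau + 2 * rl + tl - (K * l ^+ 2 + 2^-1 * tl) < 0 ->
  - tau + 2 * rl + (1 - e) ^+ 2 * tl < (1 - (1 - e) ^+ 2) / tau * l ^+ 2.
Proof.
move=> tau0 K0 e0 e1 l0 tl0 s0 rll l1 tl1 sl ts tK H.
have l2 : l ^+ 2 <= l by rewrite expr2 ler_piMl.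
have Kl : K * l ^+ 2 <= K * l by rewrite ler_wpM2l.
have sle : s <= (24 + 8 * K) * l by lra.
have K24 : 0 < 24 + 8 * K by lra.
have one : 1 <= (24 + 8 * K) ^+ 2 / s ^+ 2 * l ^+ 2.
  rewrite mulrAC ler_pdivlMr ?exprn_gt0// mul1r -exprMn.
  by rewrite ler_pXn2r ?nnegrE ?(ltW s0) ?mulr_ge0 ?(ltW K24).
have : ((24 + 8 * K) ^+ 2 / s ^+ 2 + K) * l ^+ 2 <= (1 - (1 - e) ^+ 2) / tau * l ^+ 2.
  by rewrite ler_wpM2r ?sqr_ge0// ler_pdivlMr// mulrC.
have : (1 - e) ^+ 2 * tl <= tl by rewrite ler_piMl// expr_le1//; lra.
lra.
Qed.

(** [X] stands for |tau - L|^2. Multiplied by [tau], the bound for [v] is -X + (l^2 + tau tl) plus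
    an error of at most e (l^2 + tau tl). The claim follows since (1 + 2 e) (1 - e)^2 <= 1. *)
Lemma inner_estimate (R : realType) (tau K e rl l tl : R) (X v : R) :
  0 < tau -> 0 <= K -> 0 < e -> e < 1 -> 0 <= l -> 0 <= tl ->
  X = tau ^+ 2 - 2 * tau * rl + l ^+ 2 ->
  l ^+ 2 + tau * tl < (1 - e) ^+ 2 * X -> tau * K <= e ->
  v <= - tau + 2 * rl + tl + (K * l ^+ 2 + e * tl) -> v < 0.
Proof.
move=> tau0 K0 e0 e1 l0 tl0 XE lt tK vle; rewrite -(pmulr_rlt0 _ tau0).
apply: le_lt_trans (_ : tau * (- tau + 2 * rl + tl + (K * l ^+ 2 + e * tl)) < 0).
  by rewrite ler_pM2l.
have tt : 0 <= tau * tl by rewrite mulr_ge0// ltW.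
have l2 : 0 <= l ^+ 2 by exact: sqr_ge0.
have X0 : 0 < X.
  have : 0 < (1 - e) ^+ 2 * X by apply: le_lt_trans lt; rewrite addr_ge0.
  by rewrite pmulr_rgt0// exprn_gt0// subr_gt0.
have tKl : tau * K * l ^+ 2 <= e * l ^+ 2 by rewrite ler_wpM2r.
have H1 : (1 + 2 * e) * (l ^+ 2 + tau * tl) < (1 + 2 * e) * ((1 - e) ^+ 2 * X).
  by rewrite ltr_pM2l//; lra.
have H2 : (1 + 2 * e) * ((1 - e) ^+ 2 * X) <= X.
  rewrite mulrA ler_piMl// ?(ltW X0)//.
  rewrite -subr_ge0 (_ : _ - _ = e ^+ 2 * (1 + 2 * (1 - e))); last ring.
  by rewrite mulr_ge0 ?sqr_ge0//; lra.
have e_l : 0 <= e * l ^+ 2 by rewrite mulr_ge0// ltW.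
have e_t : 0 <= e * (tau * tl) by rewrite mulr_ge0// ltW.
rewrite (_ : tau * _ =
    - X + (l ^+ 2 + tau * tl) + tau * K * l ^+ 2 + e * (tau * tl)); last first.
  by rewrite XE; ring.
lra.
Qed.

(** * The limit at the boundary point *)

Lemma tailsq_le_norm1 (R : realType) n (y : 'rV[R[i]]_n.+1) :
  norm1 y <= 1 -> tailsq y <= norm1 y.
Proof.
move=> y1; rewrite /norm1 big_ord_recl.
apply: (@le_trans _ _ (\sum_j normc (y 0 (lift 0 j)))).
  apply: ler_sum => j _; rewrite expr2 ler_piMl ?normc_ge0//.
  exact: le_trans (norm1_coord _ _) y1.
by rewrite lerDr normc_ge0.
Qed.

(** [V] comes from the conditions free of [e]: injectivity of the coordinates and Taylor's formula
    with constant 1/2. Given [e], the finer Taylor formula holds within [rr] of [xi], and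
    [outer_far] treats the rest of [U0]. *)
Lemma squeezing_near (R : realType) n (Omega U : set 'rV[R[i]]_n.+1)
    (rho : 'rV[R[i]]_n.+1 -> R) (xi : 'rV[R[i]]_n.+1) :
  nbhs xi U -> Ck_on 2 U rho -> Omega `&` U = [set z | U z /\ rho z < 0] ->
  rho xi = 0 -> cgrad rho xi != 0 ->
  (forall t, complex_tangent rho xi t -> t <> 0 -> 0 < levi_form rho xi t) ->
  exists2 V : set 'rV[R[i]]_n.+1, nbhs xi V &
  forall U0 : set 'rV[R[i]]_n.+1, open_nbhs xi U0 -> U0 `<=` V ->
  forall e : R, 0 < e -> e < 1 -> exists2 r : R, 0 < r &
  forall z, (Omega `&` U0) z -> norm1 (z - xi) < r ->
    (1 - e) * (1 - e) <= squeezing (Omega `&` U0) z.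
Proof.
move=> Uxi C2 OmegaE rho_xi grad_neq0 levi_pos.
have [P [B [K [Pu Pb K0 taylor]]]] := normal_form Uxi C2 grad_neq0 levi_pos.
have [c c0 cB] := normc_bilinear B.
have [cp cp0 cP] := norm1_mulmx P.
(* The bound 1/4 gives |y| <= 1 and |L| <= 2 |y| <= 1 for [outer_far]; 1/16 is the constant of
   [qform_inj]. *)
pose kap : R := Num.min 4^-1 (16^-1 / c).
have kap0 : 0 < kap by rewrite lt_min divr_gt0 ?invr_gt0 ?andbT.
have [r1 r10 small] := near_small xi Pu kap0.
have q0 : 0 < 4^-1 :> R by rewrite invr_gt0.
have h0 : 0 < 2^-1 :> R by rewrite invr_gt0.
have [r2 r20 gnear] := grad_coord_near Uxi C2 Pb q0.
have [r3 r30 taylor_half] := taylor _ h0.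
have [r4 r40 head] := qform_head Uxi C2 Pu Pb B (ltr01 : 0 < 1 :> R).
have /nbhs_norm1P[r5 r50 rU] := Uxi.
pose rV := Num.min r1 (Num.min r2 (Num.min r3 (Num.min r4 r5))).
have rV0 : 0 < rV by rewrite !lt_min r10 r20 r30 r40.
have rVlt (x : R) : x < rV -> [/\ x < r1, x < r2, x < r3, x < r4 & x < r5].
  by rewrite /rV !lt_min => /and5P[].
clearbody rV.
exists [set w | norm1 (w - xi) < rV]; first by apply/nbhs_norm1P; exists rV.
move=> U0 U0xi U0V e e0 e1.
have /nbhs_norm1P[r6 r60 rU0] := open_nbhs_nbhs U0xi.
have [re re0 taylor_e] := taylor _ e0.
pose rr := Num.min re (Num.min r6 rV).
have rr0 : 0 < rr by rewrite !lt_min re0 r60 rV0.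
have rr_re : rr <= re by rewrite /rr ge_min lexx.
have rr_r6 : rr <= r6 by rewrite /rr !ge_min lexx orbT.
have rr_rV : rr <= rV by rewrite /rr !ge_min lexx !orbT.
have m0 : 0 < n.+1%:R :> R by rewrite ltr0n.
(* A lower bound for |y_0|^2 + |y'|^2 at points outside the [rr]-ball: there |y P| >= rr / 2,
   because [z] is within rr / 2 of [xi]. *)
pose s : R := (rr / 2 / cp) ^+ 2 / n.+1%:R.
have s0 : 0 < s by rewrite divr_gt0// exprn_gt0// !divr_gt0.
(* 1/8 is required by [qform_solve]; 52 = 4 * 13 makes the displacement y P at most rr / 4 when |y|
   <= 13 eta. *)
pose eta : R := Num.min (8^-1 / c) (rr / (52 * cp)).
have eta0 : 0 < eta.
  by rewrite lt_min; apply/andP; split; rewrite divr_gt0 ?mulr_gt0 ?invr_gt0.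
have ceta : c * eta <= 8^-1.
  by rewrite mulrC -ler_pdivlMr// /eta ge_min lexx.
have pe0 : 0 < 1 - (1 - e) ^+ 2.
  by rewrite subr_gt0 expr_lt1//; move: e0 e1; clear; lra.
pose M := (24 + 8 * K) ^+ 2 / s ^+ 2 + K.
have M0 : 0 <= M by rewrite addr_ge0// divr_ge0 ?sqr_ge0.
have KM : K <= M by rewrite lerDr divr_ge0 ?sqr_ge0.
(* In order: the gain over [M], and so over [K], in the outer estimates; tau <= s / 8 in
   [outer_far]; tau K <= e in [inner_estimate]; the two size conditions relating [tau] to [eta].
   Adding 1 keeps the denominators positive. *)
pose t0 := Num.min ((1 - (1 - e) ^+ 2) / (M + 1))
   (Num.min (s / 8) (Num.min (e / (K + 1))
   (Num.min (eta * e) (eta ^+ 2 / n.+1%:R * e ^+ 2)))).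
have t00 : 0 < t0.
  rewrite !lt_min; apply/and5P; split.
  - by rewrite divr_gt0// ltr_wpDl.
  - by rewrite divr_gt0.
  - by rewrite divr_gt0// ltr_wpDl.
  - by rewrite mulr_gt0.
  - by rewrite mulr_gt0 ?divr_gt0 ?exprn_gt0.
have [r7 r70 rho_small] : exists2 r : R, 0 < r &
    forall z, norm1 (z - xi) < r -> - rho z < t0.
  have /rdifferentiable_continuous := proj1 C2 _ (nbhs_singleton Uxi).
  move=> /(_ [set x | - t0 < x]).
  rewrite /= rho_xi => H; have /H/nbhs_norm1P[r r0 rP] : nbhs (0 : R) [set x | - t0 < x].
    by apply: lt_nbhsr; rewrite oppr_lt0.
  by exists r => // z /rP/=; rewrite ltrNl.
pose r8 := Num.min (rr / 2) (Num.min rV r7).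
have r80 : 0 < r8 by rewrite lt_min divr_gt0// lt_min rV0.
exists r8 => // z [Oz U0z]; rewrite /r8 !lt_min => /and3P[z1 z2 z3].
have zrr : norm1 (z - xi) < rr by move: z1 rr0; clear; lra.
have [zr1 zr2 zr3 zr4 zr5] := rVlt _ z2.
have rz : rho z < 0.
  have : (Omega `&` U) z by split=> //; exact: rU.
  by rewrite OmegaE => -[].
pose tau := - rho z.
have tau0 : 0 < tau by rewrite oppr_gt0.
have := rho_small z z3; rewrite -/tau /t0 !lt_min => /and5P[T1 T2 T3 T4 T5].
have tM : tau * M <= 1 - (1 - e) ^+ 2.
  rewrite ltr_pdivlMr in T1; last by rewrite ltr_wpDl.
  apply: le_trans (ltW T1); rewrite ler_wpM2l ?(ltW tau0)// lerDl.
  exact: ler01.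
have tK : tau * K <= 1 - (1 - e) ^+ 2.
  by apply: le_trans tM; rewrite ler_wpM2l// ltW.
have tKe : tau * K <= e.
  rewrite ltr_pdivlMr in T3; last by rewrite ltr_wpDl.
  apply: le_trans (ltW T3); rewrite ler_wpM2l ?(ltW tau0)// lerDl.
  exact: ler01.
apply: (@squeezing_lower _ _ _ z P B (P *m cgrad rho z) c tau e eta) => //.
- by move=> j; exact: gnear.
- by rewrite ler_pdivrMr// ltW.
- by rewrite mulrC -ler_pdivlMr// ler_pdivrMr ?exprn_gt0// ltW.
- move=> w [Ow U0w] y.
  have wE : w = z + y *m P by rewrite /y mulmxKV// addrC subrK.
  clearbody y.
  have wV : norm1 (w - xi) < rV by exact: U0V.
  have rw : rho w < 0.
    have : (Omega `&` U) w.
      by split=> //; apply: rU; have [] := rVlt _ wV.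
    by rewrite OmegaE => -[].
  have [w1 w2 w3 w4 w5] : [/\ norm1 (z + y *m P - xi) < r1, norm1 (z + y *m P - xi) < r2,
      norm1 (z + y *m P - xi) < r3, norm1 (z + y *m P - xi) < r4 &
      norm1 (z + y *m P - xi) < r5] by apply: rVlt; rewrite -wE.
  have ysm := small z y zr1 w1.
  move: ysm; rewrite /kap le_min => /andP[y4 y16].
  have cy : c * norm1 y <= 16^-1 by rewrite mulrC -ler_pdivlMr.
  split=> //.
  have tl0 := tailsq_ge0 y.
  set L := qform _ _ _; have l0 : 0 <= normc L by exact: normc_ge0.
  have [near|far] := ltP (norm1 (w - xi)) rr.
    have H : `|rho w - rho z - 2 * complex.Re L - tailsq y| <=
        K * normc L ^+ 2 + e * tailsq y.
      rewrite wE; apply: taylor_e; first exact: lt_le_trans rr_re.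
      by rewrite -wE; exact: lt_le_trans rr_re.
    apply: (@outer_near _ tau K e) => //.
    move: H; rewrite ler_norml => /andP[H _].
    by apply: le_lt_trans rw; move: H; rewrite /tau; clear; lra.
  have H : `|rho w - rho z - 2 * complex.Re L - tailsq y| <=
      K * normc L ^+ 2 + 2^-1 * tailsq y by rewrite wE; exact: taylor_half.
  have y0 := norm1_ge0 y.
  have Ly : normc L <= 2 * norm1 y.
    by apply: (qform_le (fun j => gnear z j zr2) cB); move: cy; clear; lra.
  have y1 : norm1 y <= 1 by move: y4; clear; lra.
  apply: (@outer_far _ tau K e _ _ _ s) => //; rewrite ?(ltW T2)//.
  - by have := ler_Re_normc L; rewrite ler_norml => /andP[].
  - by move: Ly y4; clear; lra.
  - exact: le_trans (tailsq_le_norm1 y1) y1.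
  (* [qform_head] with constant 1 gives |y_0|^2 + |y'|^2 <= 4 |L|^2 + 2 |y'|^2, the form in which
     [outer_far] takes [s]. *)
  - have := head z y zr4 w4; rewrite mul1r -/L => hd.
    have yP : rr / 2 / cp <= norm1 y.
      rewrite ler_pdivrMr// [norm1 y * _]mulrC; apply: le_trans (cP y).
      have -> : y *m P = (w - xi) - (z - xi).
        by rewrite wE opprB addrA subrK addrAC subrr add0r.
      have := norm1D ((w - xi) - (z - xi)) (z - xi); rewrite subrK.
      by move: far z1; clear; lra.
    apply: (@le_trans _ _ (normc (y 0 0) ^+ 2 + tailsq y)); last by move: hd; clear; lra.
    rewrite /s ler_pdivrMr// [_ * n.+1%:R]mulrC; apply: le_trans (norm1_sq y).
    rewrite ler_pXn2r ?nnegrE//.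
    by rewrite !divr_ge0// ltW.
  - move: H; rewrite ler_norml => /andP[H _]; apply: le_lt_trans rw.
    by move: H; rewrite /tau; clear; lra.
move=> y y13 Lt lt.
have yr : norm1 (z + y *m P - xi) < rr.
  rewrite addrAC; apply: le_lt_trans (norm1D _ _) _.
  have : norm1 (y *m P) <= rr / 4; last by move: z1 rr0; clear; lra.
  apply: le_trans (cP y) _; rewrite mulrC -ler_pdivlMr//; apply: le_trans y13 _.
  have : eta <= rr / (52 * cp) by rewrite /eta ge_min lexx orbT.
  rewrite (_ : rr / 4 / cp = 13 * (rr / (52 * cp))); first by clear; lra.
  by field; rewrite gt_eqF.
split; last by apply: rU0; exact: lt_le_trans rr_r6.
suff : (Omega `&` U) (z + y *m P) by case.
rewrite OmegaE; split.
  by apply: rU; have [] := rVlt _ (lt_le_trans yr rr_rV).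
apply: (inner_estimate tau0 K0 e0 e1 (normc_ge0 _) (tailsq_ge0 y)
  (normc_realB _ _) lt tKe).
have := taylor_e z y (lt_le_trans zrr rr_re) (lt_le_trans yr rr_re).
rewrite ler_norml => /andP[_ H].
by move: H; rewrite /tau; clear; lra.
Qed.

Theorem theorem1p1 (R : realType) (n : nat)
    (Omega : set 'rV[R[i]]_n.+1) (xi0 : 'rV[R[i]]_n.+1)
    (domOmega : domain Omega) (bndOmega : bounded_set Omega)
    (xi0_bd : boundary Omega xi0)
    (spsc : C2_strongly_pseudoconvex_at Omega xi0) :
  exists2 V : set 'rV[R[i]]_n.+1, nbhs xi0 V &
    forall U0 : set 'rV[R[i]]_n.+1,
      open_nbhs xi0 U0 -> U0 `<=` V -> domain (Omega `&` U0) ->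
      squeezing (Omega `&` U0) z
        @[z --> within (Omega `&` U0) (nbhs xi0)] --> (1 : R).
Proof.
have [U [rho [[Unb C2] grad OmegaE bdE levi]]] := spsc.
have Uxi := open_nbhs_nbhs Unb.
have [_ rho_xi] : U xi0 /\ rho xi0 = 0.
  have : (boundary Omega `&` U) xi0 by split=> //; exact: nbhs_singleton.
  by rewrite bdE.
have [v v0] := grad xi0 (nbhs_singleton Uxi) xi0_bd.
have g0 := cgrad_neq0 v0.
have [V nV HV] := squeezing_near Uxi C2 OmegaE rho_xi g0 levi.
exists V => // U0 U0xi U0V _ S /nbhs_ballP[d /= d0 dS].
(* (1 - e)^2 >= 1 - 2 e >= 1 - d / 2, so the squeezing function is within [d] of 1. *)
pose e : R := Num.min (2^-1) (d / 4).
have e0 : 0 < e by rewrite lt_min; apply/andP; split; rewrite ?invr_gt0 ?divr_gt0.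
have [e2 ed] : e <= 2^-1 /\ e <= d / 4 by split; rewrite /e ge_min lexx ?orbT.
have e1 : e < 1 by lra.
have [r r0 rP] := HV U0 U0xi U0V e e0 e1.
change (nbhs xi0 [set z | (Omega `&` U0) z -> S (squeezing (Omega `&` U0) z)]).
apply/nbhs_norm1P; exists r => // z zr Dz; apply: dS.
have lo := rP z Dz zr; have hi := squeezing_le1 (Omega `&` U0) z.
rewrite -ball_normE/= ger0_norm ?subr_ge0//.
have : 1 - 2 * e <= (1 - e) * (1 - e).
  by rewrite -subr_ge0 (_ : _ - _ = e ^+ 2) ?sqr_ge0//; ring.
move=> H; lra.
Qed.
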